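(* Let $V$ be a set of $n$ variables (identified with $[n]$), let $q>0$, and let $E_1,\dots,E_k$ be conditional linear expressions over $V$. Consider the max-linear inequality $$q\cdot h(V)\le\max_{\ell\in[k]}E_\ell(h).\qquad( * )$$ (i) Suppose every $E_\ell$, $\ell\in[k]$, is unconditioned. Then $( * )$ holds for all $h\in\mathcal{M}_n$ if and only if it holds for all $h\in\Gamma_n$. (ii) Suppose every $E_\ell$, $\ell\in[k]$, is simple. Then $( * )$ holds for all $h\in\mathcal{N}_n$ if and only if it holds for all $h\in\Gamma_n$. In particular, the class of inequalities of the form $( * )$ in which every $E_\ell$ is simple is essentially Shannon (each such inequality holds for all $h\in\Gamma_n^*$ if and only if it holds for all $h\in\Gamma_n$) and decidable (there is an algorithm that, given such an inequality, decides whether it holds for all $h\in\Gamma_n^*$).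
   Context: All functions $h$ are of the form $h:2^V\to\mathbb{R}_+$. $\Gamma_n^*$ is the set of entropic functions: $h(X)$ is the Shannon entropy (base 2) of the joint marginal of the variables in $X$, for some joint distribution of $n$ random variables with finite domains. $\Gamma_n$ is the set of polymatroids: $h(\emptyset)=0$, $h(X)\le h(X\cup Y)$, and $h(X\cup Y)+h(X\cap Y)\le h(X)+h(Y)$ for all $X,Y\subseteq V$. $\mathcal{M}_n$ is the set of modular functions: $h(\emptyset)=0$ and $h(X\cup Y)+h(X\cap Y)=h(X)+h(Y)$ for all $X,Y\subseteq V$. For $W\subsetneq V$ the step function $h_W$ is $h_W(X)=0$ if $X\subseteq W$ and $h_W(X)=1$ otherwise. $\mathcal{N}_n$ is the set of normal functions: $\sum_{W\subsetneq V}c_Wh_W$ with $c_W\ge0$. Write $h(Y|X)=h(X\cup Y)-h(X)$. A conditional linear expression is $E(h)=\sum_{X\subseteq Y\subseteq V}d_{Y|X}\,h(Y|X)$ with coefficients $d_{Y|X}\ge0$. It is simple if $d_{Y|X}>0$ implies $|X|\le1$; it is unconditioned if $d_{Y|X}>0$ implies $X=\emptyset$. For the decidability claim, coefficients of the input inequality are taken to be integers (equivalently rationals). *)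

(* Defs.v *)
From HB Require Import structures.
From mathcomp Require Import all_boot all_order all_algebra.
From mathcomp Require Import boolp reals exp.
Set Implicit Arguments.
Unset Strict Implicit.
Unset Printing Implicit Defensive.
Import Order.TTheory GRing.Theory Num.Theory.
Local Open Scope ring_scope.

(* The variables are V = 'I_n; a set function is h : {set 'I_n} -> R. *)

Definition polymatroid (R : realType) (n : nat) (h : {set 'I_n} -> R) : Prop :=
  [/\ forall X, 0 <= h X,
      h set0 = 0,
      forall X Y, h X <= h (X :|: Y) &
      forall X Y, h (X :|: Y) + h (X :&: Y) <= h X + h Y].

Definition modular (R : realType) (n : nat) (h : {set 'I_n} -> R) : Prop :=
  [/\ forall X, 0 <= h X,
      h set0 = 0 &
      forall X Y, h (X :|: Y) + h (X :&: Y) = h X + h Y].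

Definition step (R : realType) (n : nat) (W X : {set 'I_n}) : R :=
  if X \subset W then 0 else 1.

Definition normal (R : realType) (n : nat) (h : {set 'I_n} -> R) : Prop :=
  exists c : {set 'I_n} -> R,
    (forall W : {set 'I_n}, W \proper [set: 'I_n] -> 0 <= c W) /\
    (forall X, h X = \sum_(W : {set 'I_n} | W \proper [set: 'I_n])
                       c W * step R W X).

Definition log2 (R : realType) (x : R) : R := ln x / ln 2.

(* In this library ln 0 = 0, so the convention 0 log 0 = 0 is automatic. *)
Definition shannon (R : realType) (T : finType) (p : T -> R) : R :=
  - \sum_(t : T) p t * log2 (p t).

(* Tuples of values for the variables in X. *)
Definition valuation (n : nat) (D : 'I_n -> finType) (X : {set 'I_n}) : finType :=
  {dffun forall i : {i : 'I_n | i \in X}, D (val i)}.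

Definition restrict (n : nat) (D : 'I_n -> finType) (X : {set 'I_n})
    (w : {dffun forall i : 'I_n, D i}) : valuation D X :=
  [ffun i : {i : 'I_n | i \in X} => w (val i)].

Definition marginal (R : realType) (n : nat) (D : 'I_n -> finType)
    (p : {dffun forall i : 'I_n, D i} -> R) (X : {set 'I_n})
    (t : valuation D X) : R :=
  \sum_(w | restrict X w == t) p w.

Definition entropic (R : realType) (n : nat) (h : {set 'I_n} -> R) : Prop :=
  exists (D : 'I_n -> finType) (p : {dffun forall i : 'I_n, D i} -> R),
    [/\ forall w, 0 <= p w,
        \sum_w p w = 1 &
        forall X, h X = shannon (marginal p (X := X))].

Definition cond (R : realType) (n : nat) (h : {set 'I_n} -> R)
    (Y X : {set 'I_n}) : R :=
  h (X :|: Y) - h X.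

(* The coefficient d_{Y|X} is [d Y X]; entries with X not included in Y are
   never used. *)
Definition coefs (K : Type) (n : nat) : Type := {set 'I_n} -> {set 'I_n} -> K.

Definition linear_expr (R : realType) (n : nat) (d : coefs R n)
    (h : {set 'I_n} -> R) : R :=
  \sum_(X : {set 'I_n}) \sum_(Y : {set 'I_n} | X \subset Y)
    d Y X * cond h Y X.

Definition conditional (R : realType) (n : nat) (d : coefs R n) : Prop :=
  forall X Y : {set 'I_n}, X \subset Y -> 0 <= d Y X.

Definition simple (R : realType) (n : nat) (d : coefs R n) : Prop :=
  forall X Y : {set 'I_n}, X \subset Y -> 0 < d Y X -> (#|X| <= 1)%N.

Definition unconditioned (R : realType) (n : nat) (d : coefs R n) : Prop :=
  forall X Y : {set 'I_n}, X \subset Y -> 0 < d Y X -> X = set0.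

(* There are k.+1 >= 1 expressions, so that the maximum is over a nonempty
   set; the base point of the iterated maximum is one of its members. *)
Definition max_linear_ineq (R : realType) (n k : nat) (q : R)
    (d : 'I_k.+1 -> coefs R n) (h : {set 'I_n} -> R) : Prop :=
  q * h [set: 'I_n] <=
  \big[Num.max/linear_expr (d ord0) h]_(l < k.+1) linear_expr (d l) h.

Definition valid_on (R : realType) (n k : nat) (C : ({set 'I_n} -> R) -> Prop)
    (q : R) (d : 'I_k.+1 -> coefs R n) : Prop :=
  forall h, C h -> max_linear_ineq q d h.

(* Total recursive functions of k natural-number arguments.  Minimization is
   applied to regular functions only: the premise of [recursive_mu] says that
   h v is the least zero of x |-> g (x, v), which therefore always exists.
   Being inductively generated, this is not trivialized by classical axioms,
   unlike the existence of a mere Rocq function. *)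
Inductive recursive : forall k : nat, (k.-tuple nat -> nat) -> Prop :=
| recursive_zero k : recursive (fun _ : k.-tuple nat => 0%N)
| recursive_succ : recursive (fun v : 1.-tuple nat => (tnth v ord0).+1)
| recursive_proj k (i : 'I_k) : recursive (fun v : k.-tuple nat => tnth v i)
| recursive_comp k m (g : m.-tuple nat -> nat) (f : 'I_m -> k.-tuple nat -> nat)
    (h : k.-tuple nat -> nat) :
    recursive g -> (forall i, recursive (f i)) ->
    (forall v, h v = g [tuple f i v | i < m]) -> recursive h
| recursive_prim k (f : k.-tuple nat -> nat) (g : k.+2.-tuple nat -> nat)
    (h : k.+1.-tuple nat -> nat) :
    recursive f -> recursive g ->
    (forall v : k.-tuple nat, h [tuple of 0%N :: v] = f v) ->
    (forall x (v : k.-tuple nat),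
        h [tuple of x.+1 :: v] = g [tuple of x :: h [tuple of x :: v] :: v]) ->
    recursive h
| recursive_mu k (g : k.+1.-tuple nat -> nat) (h : k.-tuple nat -> nat) :
    recursive g ->
    (forall v : k.-tuple nat, g [tuple of h v :: v] = 0%N) ->
    (forall (v : k.-tuple nat) y, (y < h v)%N -> g [tuple of y :: v] <> 0%N) ->
    recursive h.

(* The subset of 'I_n whose indicator is the binary expansion of x; this is a
   bijection from {0, ..., 2^n - 1} to {set 'I_n}. *)
Definition bits (n x : nat) : {set 'I_n} := [set i : 'I_n | odd (x %/ 2 ^ i)%N].

(* Input code of q * h(V) <= max_l E_l(h) with natural coefficients: n, q, the
   number of expressions, and the tables of coefficients of E_0, ..., E_k, the
   subsets X, then Y, being enumerated in binary order.  CodeSeq.code is the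
   standard effective bijection between sequences of numbers and numbers. *)
Definition encode (n k q : nat) (d : 'I_k.+1 -> coefs nat n) : nat :=
  CodeSeq.code [:: n, q, k.+1 &
    flatten [seq [seq d l (bits n y) (bits n x)
                 | x <- iota 0 (2 ^ n)%N, y <- iota 0 (2 ^ n)%N]
            | l <- enum 'I_k.+1]].

Definition real_coefs (R : realType) (n : nat) (d : coefs nat n) : coefs R n :=
  fun Y X => (d Y X)%:R.

(* Decidability, for simple expressions with (nonnegative) integer
   coefficients, of validity over the entropic functions. *)
Definition simple_ineq_decidable (R : realType) : Prop :=
  exists f : 1.-tuple nat -> nat,
    recursive f /\
    forall (n k q : nat) (d : 'I_k.+1 -> coefs nat n),
      (0 < q)%N ->
      (forall l, simple (real_coefs R (d l))) ->
      f [tuple encode q d] =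
        nat_of_bool
          `[< valid_on (@entropic R n) q%:R (fun l => real_coefs R (d l)) >].

(* Main.v *)
(* For a polymatroid h there is a modular g <= h with g(V) = h(V) (marginal
   gains along an order of V), and a normal g <= h which agrees with h on V and
   on singletons; an unconditioned (resp. simple) expression can only decrease
   from h to g, which gives (i) and (ii).

   The entropic cone contains all nonnegative integer combinations of step
   functions, and a violation over the normal functions, being an open
   condition, is already attained at such a combination.  Hence validity over
   the entropic functions means that a finite integer system A c > 0, c >= 0 has
   no solution.  By Ville's alternative this is so if and only if some
   nonnegative nonzero integer vector l has l A <= 0, and an unbounded search
   for either certificate decides the inequality. *)
Require Import Defs.
From mathcomp Require Import all_boot all_order all_algebra.
From mathcomp Require Import boolp reals exp.
From mathcomp Require Import zify ring lra.
Import Order.TTheory GRing.Theory Num.Theory.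
Local Open Scope ring_scope.

Set Implicit Arguments.
Unset Strict Implicit.
Unset Printing Implicit Defensive.

(** * Modular and normal functions below a polymatroid *)

(** In a term h(Y|X) of a simple expression the subtracted set X is empty or a singleton, where the
    normal minorant agrees with h; only the added term moves, and it moves down.

    A maximum fails exactly when all its members fail, so a violation is a system of strict linear
    inequalities. All expressions are positively homogeneous, hence a real solution may be scaled up
    and then rounded. Integer weights need only fair bits, not distributions of prescribed real
    entropy.

    Since [recursive] is inductive, the decision procedure must be built from its constructors, and
    minimization demands a search that succeeds on every input. The theorem of the alternative gives
    this for every natural number, whether or not it encodes an inequality, and weak duality makes
    either certificate conclusive. *)

Lemma step_polymatroid (R : realType) (n : nat) (W : {set 'I_n}) :
  polymatroid (step R W).
Proof.
rewrite /step; split=> [X||X Y|X Y]; first by case: ifP.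
- by rewrite sub0set.
- by rewrite subUset; case: (X \subset W) => //=; case: ifP.
- rewrite subUset.
  have HX : X \subset W -> X :&: Y \subset W by apply: subset_trans; apply: subsetIl.
  have HY : Y \subset W -> X :&: Y \subset W by apply: subset_trans; apply: subsetIr.
  case: (X \subset W) (Y \subset W) HX HY => [] [] /=.
  + by move=> /(_ isT)-> _.
  + by move=> /(_ isT)-> _; lra.
  + by move=> _ /(_ isT)->; lra.
  + by move=> _ _; case: ifP => _; lra.
Qed.

Lemma normal_polymatroid (R : realType) (n : nat) (h : {set 'I_n} -> R) :
  normal h -> polymatroid h.
Proof.
case=> c [c0 hE]; have s (W : {set 'I_n}) := step_polymatroid R W.
split=> [X||X Y|X Y]; rewrite ?hE.
- by apply: sumr_ge0 => W /c0 cW; rewrite mulr_ge0 //; case: (s W).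
- by rewrite big1 // => W _; case: (s W) => _ ->; rewrite mulr0.
- by apply: ler_sum => W /c0 cW; rewrite ler_wpM2l //; case: (s W).
- rewrite -!big_split; apply: ler_sum => W /c0 cW /=.
  by rewrite -!mulrDr ler_wpM2l //; case: (s W).
Qed.

Lemma modular_polymatroid (R : realType) (n : nat) (h : {set 'I_n} -> R) :
  modular h -> polymatroid h.
Proof.
case=> h0 hs hm; split=> // X Y; last by rewrite hm.
have := hm X (Y :\: X).
have -> : X :|: Y :\: X = X :|: Y by apply/setP => i; rewrite !inE; case: (i \in X).
have -> : X :&: (Y :\: X) = set0 by apply/setP => i; rewrite !inE; case: (i \in X).
by rewrite hs addr0 => ->; rewrite lerDl.
Qed.

Lemma polymatroid_subset (R : realType) (n : nat) (h : {set 'I_n} -> R) (X Y : {set 'I_n}) :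
  polymatroid h -> X \subset Y -> h X <= h Y.
Proof. by case=> _ _ hm _ /setUidPr <-. Qed.

(** The vertex of the base polytope of [h] that the greedy algorithm finds for the natural order of
    the variables. *)
Definition chain (R : realType) (n : nat) (h : {set 'I_n} -> R) (X : {set 'I_n}) : R :=
  \sum_(i in X) (h [set j : 'I_n | (j <= i)%N] - h [set j : 'I_n | (j < i)%N]).

Lemma chain_modular (R : realType) (n : nat) (h : {set 'I_n} -> R) :
  polymatroid h -> modular (chain h).
Proof.
move=> ph; split=> [X||X Y]; rewrite /chain.
- apply: sumr_ge0 => i _; rewrite subr_ge0; apply: polymatroid_subset => //.
  by apply/subsetP => j; rewrite !inE; apply: ltnW.
- by rewrite big_set0.
- rewrite !(big_mkcond (fun i => i \in _)) -!big_split; apply: eq_bigr => i _ /=.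
  by rewrite !inE; case: (i \in X); case: (i \in Y); rewrite /= ?addr0 ?add0r.
Qed.

Lemma chain_prefix (R : realType) (n : nat) (h : {set 'I_n} -> R) (X : {set 'I_n}) m :
  polymatroid h -> (m <= n)%N ->
  chain h (X :&: [set j : 'I_n | (j < m)%N]) <= h (X :&: [set j : 'I_n | (j < m)%N]) /\
  chain h [set j : 'I_n | (j < m)%N] = h [set j : 'I_n | (j < m)%N].
Proof.
move=> ph; have [_ h0 _ hs] := ph; elim: m => [|m IH] mn.
  have -> : [set j : 'I_n | (j < 0)%N] = set0 by apply/setP => j; rewrite !inE.
  by rewrite setI0 /chain big_set0 h0.
have [IH1 IH2] := IH (ltnW mn); pose i := Ordinal mn.
have iN : i \notin [set j : 'I_n | (j < m)%N] by rewrite inE ltnn.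
have eS : [set j : 'I_n | (j < m.+1)%N] = i |: [set j : 'I_n | (j < m)%N].
  by apply/setP => j; rewrite !inE ltnS leq_eqVlt -val_eqE.
have e2 : chain h (i |: [set j : 'I_n | (j < m)%N]) = h (i |: [set j : 'I_n | (j < m)%N]).
  by rewrite /chain big_setU1 //= [X in _ + X]IH2 -eS; ring.
rewrite eS; split=> //; have [iX|iX] := boolP (i \in X); last first.
  suff -> : X :&: (i |: [set j : 'I_n | (j < m)%N]) = X :&: [set j : 'I_n | (j < m)%N] by [].
  by apply/setP => j; rewrite !inE; case: eqP => // ->; rewrite ltnn (negPf iX).
have eX : X :&: (i |: [set j : 'I_n | (j < m)%N]) = i |: (X :&: [set j : 'I_n | (j < m)%N]).
  by apply/setP => j; rewrite !inE; case: eqP => // ->; rewrite iX.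
rewrite eX /chain big_setU1 /=; last by rewrite !inE ltnn andbF.
(* Submodularity: [i] gains no more over the whole prefix than over the part of it inside [X]. *)
have := hs (i |: (X :&: [set j : 'I_n | (j < m)%N])) [set j : 'I_n | (j < m)%N].
have -> : (i |: (X :&: [set j : 'I_n | (j < m)%N])) :|: [set j : 'I_n | (j < m)%N] =
    [set j : 'I_n | (j < m.+1)%N].
  by apply/setP => j; rewrite eS !inE; case: eqP => //= _; case: (j \in X); rewrite /= ?orbb.
have -> : (i |: (X :&: [set j : 'I_n | (j < m)%N])) :&: [set j : 'I_n | (j < m)%N] =
    X :&: [set j : 'I_n | (j < m)%N].
  by apply/setP => j; rewrite !inE; case: eqP => [->|_] /=;
    [rewrite ltnn andbF|rewrite -andbA andbb].
by move: IH1; rewrite /chain /=; lra.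
Qed.

Lemma normalD (R : realType) (n : nat) (h g : {set 'I_n} -> R) :
  normal h -> normal g -> normal (fun X => h X + g X).
Proof.
move=> [c [c0 hE]] [d [d0 gE]]; exists (fun W => c W + d W); split=> [W pW|X].
  by rewrite addr_ge0 ?c0 ?d0.
by rewrite hE gE -big_split; apply: eq_bigr => W _; rewrite mulrDl.
Qed.

Lemma normal0 (R : realType) (n : nat) : @normal R n (fun=> 0).
Proof.
by exists (fun=> 0); split => // X; rewrite big1 // => W _; rewrite mul0r.
Qed.

Lemma normal_step (R : realType) (n : nat) (W : {set 'I_n}) (c : R) :
  W \proper setT -> 0 <= c -> normal (fun X => c * step R W X).
Proof.
move=> pW c0; exists (fun W' => if W' == W then c else 0).
split=> [W' _|X]; first by case: ifP.
rewrite (bigD1 W) //= eqxx big1 ?addr0 // => W' /andP[_ /negPf->].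
by rewrite mul0r.
Qed.

(* Peel off the least positive weight, which multiplies the step function of
   the set of zero weights. *)
Lemma normal_max (R : realType) (n : nat) (a : 'I_n -> R) :
  (forall i, 0 <= a i) ->
  exists2 h : {set 'I_n} -> R, normal h & [/\ h set0 = 0,
    forall (X : {set 'I_n}) i, i \in X -> a i <= h X &
    forall X : {set 'I_n}, X != set0 -> exists2 i, i \in X & h X = a i].
Proof.
have [N] := ubnP #|[set i | a i != 0]|; elim: N a => // N IH a cN a0.
have [[i0 i0P]|z] := pselect (exists i, a i != 0); last first.
  have az i : a i = 0 by apply: contrapT => /eqP ai; apply: z; exists i.
  exists (fun=> 0); first exact: normal0.
  by split=> // [X i|X /set0Pn[i iX]]; [rewrite az|exists i].
have [m mP mmin] := arg_minP (P := fun i => a i != 0) a i0P.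
have m0 : 0 < a m by rewrite lt_neqAle eq_sym mP a0.
pose W := [set i | a i == 0].
pose b i := if i \in W then 0 else a i - a m.
have [|i|h nh [h0 hge hmax]] := IH b.
- rewrite (leq_trans _ (cN : (_ <= N)%N)) //; apply: proper_card; apply/properP; split.
    by apply/subsetP => i; rewrite !inE /b inE; case: (a i == 0); rewrite ?eqxx.
  by exists m; rewrite !inE // /b inE (negPf mP) subrr eqxx.
- by rewrite /b inE; case: ifPn => // ai; rewrite subr_ge0 mmin.
have bE i : a i = b i + (i \notin W)%:R * a m.
  by rewrite /b inE; case: eqP => [->|_] /=; rewrite ?mul0r ?addr0 ?mul1r ?subrK.
have pW : W \proper setT.
  by rewrite properT; apply/negP => /eqP /setP /(_ m); rewrite !inE (negPf mP).
exists (fun X => h X + a m * step R W X).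
  by apply: normalD => //; apply: normal_step => //; apply: ltW.
split=> [|X i iX|X X0].
- by rewrite h0 /step sub0set mulr0 addr0.
- have := hge X i iX; rewrite (bE i) /step.
  case: (boolP (X \subset W)) => [/subsetP /(_ i iX) -> /=|_];
    first by rewrite mul0r mulr0; lra.
  by case: (i \notin W) => /=; lra.
- have [i iX e] := hmax X X0; rewrite /step.
  have [/subsetP XW|/subsetPn[j jX jW]] := boolP (X \subset W).
    by exists i => //; rewrite (bE i) e (XW _ iX) /= mul0r mulr0.
  have [iW|iW] := boolP (i \in W); last by exists i => //; rewrite (bE i) e iW mul1r mulr1.
  (* Here [h X = b i = 0], so [b j], which lies between 0 and [h X], vanishes too, and [j] attains
     the maximum. *)
  exists j => //; rewrite (bE j) jW mulr1 mul1r; congr (_ + _); apply/le_anti.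
  by rewrite (hge X j jX) e andbT {1}/b iW /b (negPf jW) subr_ge0 mmin //; move: jW;
    rewrite inE.
Qed.

Lemma contraction_polymatroid (R : realType) (n : nat) (h : {set 'I_n} -> R) (Z : {set 'I_n}) :
  polymatroid h -> polymatroid (fun X => h (Z :|: X) - h Z).
Proof.
move=> ph; have [_ _ hm hs] := ph; split=> [X||X Y|X Y].
- by rewrite subr_ge0 hm.
- by rewrite setU0 subrr.
- by rewrite lerD2r setUA hm.
- have := hs (Z :|: X) (Z :|: Y).
  have -> : (Z :|: X) :|: (Z :|: Y) = Z :|: (X :|: Y) by rewrite setUACA setUid.
  by rewrite -setUIr; lra.
Qed.

(* With [a i] the mutual information of [i] and [v], the function [h] splits
   into the maximum of [a] over a set and a normal function below the
   contraction of [h] by [v]. *)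
Lemma normal_minorant (R : realType) (n : nat) (h : {set 'I_n} -> R) :
  polymatroid h ->
  exists2 g, normal g & [/\ forall X, g X <= h X, g setT = h setT &
    forall i, g [set i] = h [set i]].
Proof.
have [N] := ubnP #|[set i | h [set i] != 0]|; elim: N h => // N IH h cN ph.
have [h_ge0 h0 hm hs] := ph.
have [[v vP]|z] := pselect (exists i, h [set i] != 0); last first.
  have az i : h [set i] = 0 by apply: contrapT => /eqP ai; apply: z; exists i.
  have hz X : h X = 0.
    have [k] := ubnP #|X|; elim: k X => // k IHk X kX.
    have [->|[i iX]] := set_0Vmem X; first by rewrite h0.
    apply/le_anti; rewrite h_ge0 andbT -(setD1K iX).
    have := hs [set i] (X :\ i); rewrite az (IHk (X :\ i)).
      by have := h_ge0 ([set i] :&: (X :\ i)); lra.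
    by move: kX; rewrite (cardsD1 i) iX.
  by exists (fun=> 0); [exact: normal0|split => *; rewrite hz].
pose a i := h [set i] + h [set v] - h [set v; i].
have a0 i : 0 <= a i.
  have := hs [set v] [set i]; have := h_ge0 ([set v] :&: [set i]); rewrite /a; lra.
have [g1 ng1 [g10 g1ge g1max]] := normal_max a0.
have [||g2 ng2 [g2le g2T g2s]] := IH (fun X => h (v |: X) - h [set v]).
(* Contraction by [v] makes the value at [v] zero and keeps zero singletons zero. *)
- rewrite (leq_trans _ (cN : (_ <= N)%N)) //; apply: proper_card; apply/properP; split.
    apply/subsetP => i; rewrite !inE; apply: contraNN => /eqP hi.
    apply/eqP/le_anti; have := hs [set v] [set i]; have := h_ge0 ([set v] :&: [set i]).
    by have := hm [set v] [set i]; rewrite hi; lra.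
  by exists v; rewrite !inE // setUid subrr eqxx.
- exact: contraction_polymatroid.
have av : a v = h [set v] by rewrite /a setUid addrK.
have avi i : a i <= a v.
  by rewrite av /a; have := hm [set i] [set v]; rewrite setUC; lra.
(* Write I(X;v) for h(X) + h(v) - h(X,v). For nonempty X the sum is at most max I(i;v) + h(X|v),
   over i in X, and I(i;v) <= I(X;v) bounds this by h(X). Equality holds on V, where [v] attains the
   maximum, and on singletons. *)
exists (fun X => g1 X + g2 X); first exact: normalD.
split=> [X||i].
- have [->|X0] := eqVneq X set0.
    by have := g2le set0; rewrite g10 h0 setU0; lra.
  have [i iX ->] := g1max X X0; have := g2le X.
  have [vX|vX] := boolP (v \in X).
    by have := avi i; rewrite (setUidPr _) ?sub1set // av; lra.
  have := hs X [set v; i].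
  have -> : X :|: [set v; i] = v |: X.
    by apply/setP => j; rewrite !inE; case: eqP => [->|_] /=;
      [rewrite orbT|case: eqP => [->|]; rewrite ?iX ?orbF].
  have -> : X :&: [set v; i] = [set i].
    apply/setP => j; rewrite !inE; case: eqP => [->|_] /=;
      last by rewrite andb_idl // => /eqP->.
    by rewrite (negPf vX); apply/esym/eqP => e; rewrite e iX in vX.
  by rewrite /a; lra.
- have [|i _ g1T] := g1max setT; first by apply/set0Pn; exists v; rewrite inE.
  have -> : g1 setT = a v by apply/le_anti; rewrite g1ge ?inE // g1T avi.
  by rewrite g2T setUT av; ring.
- rewrite g2s; have [|j] := g1max [set i]; first by apply/set0Pn; exists i; rewrite inE.
  by rewrite inE => /eqP-> ->; rewrite /a; ring.
Qed.

(** * Integer approximation and Ville's alternative *)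

(** Nonzero combinations of rows with natural coefficients. The inductive form lets a derivation
    from eliminated rows be replayed in the original ones, and vectors of unbounded length spare a
    change of type when an unknown is removed. *)
Inductive cone (I : Type) (P : I -> Prop) (a : I -> nat -> int) :
    (nat -> int) -> Prop :=
| cone_row i : P i -> cone P a (a i)
| cone_add u v w : cone P a u -> cone P a v ->
    (forall j, w j = u j + v j) -> cone P a w.

(** The factor is a successor because [cone] has no empty combination. *)
Lemma cone_scale (I : Type) (P : I -> Prop) (a : I -> nat -> int) (u w : nat -> int)
    (n : nat) :
  cone P a u -> (forall j, w j = n.+1%:Z * u j) -> cone P a w.
Proof.
move=> cu; elim: n w => [|n IH] w Hw.
  suff -> : w = u by [].
  by apply/funext => j; rewrite Hw mul1r.
apply: (cone_add (IH (fun j => n.+1%:Z * u j) (fun=> erefl)) cu) => j.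
by rewrite Hw -addn1 PoszD mulrDl mul1r.
Qed.

Lemma cone_coef (I : finType) (P : pred I) (a : I -> nat -> int) (v : nat -> int) :
  cone P a v -> exists2 l : I -> nat, (exists2 i, P i & (0 < l i)%N) &
    forall j, v j = \sum_(i | P i) (l i)%:Z * a i j.
Proof.
elim=> [i Pi|u1 u2 w _ [l1 [i Pi l1i] e1] _ [l2 _ e2] e].
  exists (fun k => (k == i) : nat); first by exists i => //; rewrite eqxx.
  move=> j; rewrite (bigD1 i) //= eqxx mul1r big1 ?addr0 //.
  by move=> k /andP[_ /negPf->]; rewrite mul0r.
exists (fun k => (l1 k + l2 k)%N); first by exists i => //; rewrite addn_gt0 l1i.
by move=> j; rewrite e e1 e2 -big_split; apply: eq_bigr => k _; rewrite /= PoszD mulrDl.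
Qed.

(** Chooses the value of an eliminated unknown between its lower and upper bounds; the unknown must
    also be nonnegative, so 0 counts as a lower bound. *)
Lemma exists_between (F : realFieldType) (I : finType) (A B : pred I) (f g : I -> F) :
  (forall i, B i -> 0 < g i) -> (forall i j, A i -> B j -> f i < g j) ->
  exists t : F, [/\ 0 <= t, forall i, A i -> f i < t & forall j, B j -> t < g j].
Proof.
move=> g0 fg; set L := \big[Num.max/0]_(i | A i) f i.
have L0 : 0 <= L by apply: bigmax_ge_id.
have fL i : A i -> f i <= L by move=> Ai; apply: le_bigmax_cond.
have Lg j : B j -> L < g j by move=> Bj; apply/bigmax_ltP; split; [exact: g0|move=> i Ai;
  exact: fg].
(* The default [L + 1] leaves room above [L] even when there is no upper bound. *)
set U := \big[Num.min/(L + 1)]_(j | B j) g j.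
have UL : L < U by apply/bigmin_gtP; split => //; lra.
have Ug j : B j -> U <= g j by move=> Bj; apply: bigmin_le_cond.
exists ((L + U) / 2); split; first by lra.
  by move=> i /fL; lra.
by move=> j /Ug; lra.
Qed.

(* Fourier-Motzkin elimination of the last unknown: a row whose last
   coefficient is nonpositive is kept, and a row with positive last coefficient
   is combined with each row with negative last coefficient. *)
Lemma ville (m : nat) (I : finType) (P : pred I) (a : I -> nat -> int) :
  (exists2 c : nat -> rat, forall j, 0 <= c j &
     forall i, P i -> 0 < \sum_(j < m) c j * (a i j)%:~R) \/
  (exists2 v, cone P a v & forall j, (j < m)%N -> v j <= 0).
Proof.
elim: m I P a => [|m IH] I P a.
  have [/existsP[i Pi]|/existsPn nP] := boolP [exists i, P i].
    by right; exists (a i) => //; apply: cone_row.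
  by left; exists (fun=> 0) => // i; rewrite (negPf (nP i)).
(* Keeping a row with negative last coefficient amounts to combining it with the constraint that the
   last unknown is nonnegative. *)
pose P' (x : I + I * I) := match x with
  | inl i => P i && (a i m <= 0)
  | inr (p, n) => [&& P p, P n, 0 < a p m & a n m < 0] end.
pose a' (x : I + I * I) := match x with
  | inl i => a i
  | inr (p, n) => fun j => - a n m * a p j + a p m * a n j end.
have [[c c0 Hc]|[v cv v0]] := IH _ P' a'; last first.
  right; exists v => [|j].
    elim: cv => [[i|[p n]] /= |u1 u2 w _ c1 _ c2 e]; last exact: cone_add e.
      by case/andP=> Pi _; apply: cone_row.
    case/and4P=> Pp Pn pm nm.
    have [k ek] : exists k : nat, - a n m = k.+1%:Z.
      exists `|a n m|.-1%N; rewrite prednK ?absz_gt0 ?lt_eqF //.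
      by rewrite abszE ltr0_norm.
    have [k' ek'] : exists k : nat, a p m = k.+1%:Z.
      exists `|a p m|.-1%N; rewrite prednK ?absz_gt0 ?gt_eqF //.
      by rewrite abszE gtr0_norm.
    rewrite ek ek'.
    by apply: (cone_add (cone_scale (n := k) (cone_row (i := p) _ Pp) (fun=> erefl))
      (cone_scale (n := k') (cone_row (i := n) _ Pn) (fun=> erefl))).
  (* At coordinate [m] the kept rows are nonpositive and the combined rows cancel. *)
  rewrite ltnS leq_eqVlt => /predU1P[->|]; last exact: v0.
  elim: cv {v0} => [[i|[p n]] /= |u1 u2 w _ c1 _ c2 e]; last by rewrite e; lra.
    by case/andP.
  by move=> _; rewrite mulNr mulrC addNr.
left; pose s i : rat := \sum_(j < m) c j * (a i j)%:~R.
(* Rows with positive last coefficient bound the unknown from below, those with negative one from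
   above; a lower bound lies under an upper one exactly because the combined row is positive. *)
have [||t [t0 Hp Hn]] := @exists_between rat I [pred i | P i && (0 < a i m)]
    [pred i | P i && (a i m < 0)] (fun i => - s i / (a i m)%:~R)
    (fun i => s i / - (a i m)%:~R).
- move=> i /andP[Pi im]; rewrite divr_gt0 ?oppr_gt0 ?ltrz0 //.
  by apply: (Hc (inl i)); rewrite /= Pi ltW.
- move=> p n /andP[Pp pm] /andP[Pn nm].
  rewrite ltr_pdivrMr ?ltr0z // mulrAC ltr_pdivlMr ?oppr_gt0 ?ltrz0 //.
  have /Hc : P' (inr (p, n)) by rewrite /= Pp Pn pm nm.
  have -> : \sum_(j < m) c j * (a' (inr (p, n)) j)%:~R =
     - (a n m)%:~R * s p + (a p m)%:~R * s n.
    rewrite /s !mulr_sumr -big_split; apply: eq_bigr => j _ /=.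
    by rewrite rmorphD !rmorphM rmorphN; ring.
  by lra.
exists (fun j => if j == m then t else c j) => [j|i Pi]; first by case: ifP.
rewrite big_ord_recr /= eqxx.
rewrite (eq_bigr (fun j : 'I_m => c j * (a i j)%:~R)) => [|j _]; last by rewrite ltn_eqF.
rewrite -/(s i).
have [im|im|im] := ltgtP (a i m) 0.
- have := Hn i; rewrite inE Pi im => /(_ isT).
  by rewrite ltr_pdivlMr ?oppr_gt0 ?ltrz0 //; lra.
- have := Hp i; rewrite inE Pi im => /(_ isT).
  by rewrite ltr_pdivrMr ?ltr0z //; lra.
- by rewrite im mulr0 addr0; apply: (Hc (inl i)); rewrite /= Pi im lexx.
Qed.

(** Scaling by [N] multiplies each sum by [N], whereas truncating the weights lowers it by at most
    the constant [b i]. It is used over the reals for normal functions and over the rationals for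
    solutions of [ville]. *)
Lemma nat_approximation (F : archiRealFieldType) (I J : finType) (P : pred J)
    (a : I -> J -> F) (c : J -> F) :
  (forall j, P j -> 0 <= c j) -> (forall i, 0 < \sum_(j | P j) c j * a i j) ->
  exists m : J -> nat, forall i, 0 < \sum_(j | P j) (m j)%:R * a i j.
Proof.
move=> c0 ac.
pose b i := \sum_(j | P j) `|a i j|.
pose N := \sum_i Num.bound (b i / \sum_(j | P j) c j * a i j).
exists (fun j => Num.truncn (N%:R * c j)) => i.
have HN : b i < N%:R * \sum_(j | P j) c j * a i j.
  rewrite -ltr_pdivrMr //; apply: lt_le_trans (_ : (Num.bound (b i / \sum_(j | P j) c j * a
    i j))%:R <= _).
    by apply: archi_boundP; apply: divr_ge0; [apply: sumr_ge0|apply: ltW].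
  by rewrite ler_nat /N (bigD1 i) //= leq_addr.
rewrite -subr_gt0 in HN; apply: lt_le_trans HN _.
rewrite mulr_sumr /b -sumrB; apply: ler_sum => j Pj.
have /truncn_itv/andP[h1 h2] : 0 <= N%:R * c j by rewrite mulr_ge0 ?c0.
set m := Num.truncn _ in h1 h2 *.
rewrite -natr1 in h2; move: h1 h2; set x := N%:R * c j; set y := m%:R => h1 h2.
rewrite mulrA -/x lerBlDr -lerBlDl -mulrBl.
apply: le_trans (ler_norm _) _; rewrite normrM ler_piMl //.
by rewrite ger0_norm; lra.
Qed.

(** * Entropic functions *)

(** When [e] relates points with the same restriction to X, this is the marginal probability of the
    restriction of [w]. Marginals for different X thus become functions on one sample space. *)
Definition class_weight (R : realType) (T : finType) (p : T -> R) (e : rel T) (w : T) : R :=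
  \sum_(u | e u w) p u.

Lemma class_weight_ge0 (R : realType) (T : finType) (p : T -> R) (e : rel T) (w : T) :
  (forall w, 0 <= p w) -> 0 <= class_weight p e w.
Proof. by move=> p0; apply: sumr_ge0. Qed.

Lemma class_weight_gt0 (R : realType) (T : finType) (p : T -> R) (e : rel T) (w : T) :
  (forall w, 0 <= p w) -> reflexive e -> 0 < p w -> 0 < class_weight p e w.
Proof.
move=> p0 er pw; apply: lt_le_trans pw _.
by rewrite /class_weight (bigD1 w) ?er //= lerDl sumr_ge0.
Qed.

Lemma equivalence_rel_sym (T : Type) (e : rel T) : equivalence_rel e -> symmetric e.
Proof.
move=> /equivalence_relP[er el] x y; apply/idP/idP => xy.
  by rewrite -(el _ _ xy) er.
by rewrite -(el _ _ xy) er.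
Qed.

Lemma class_weight_eq (R : realType) (T : finType) (p : T -> R) (e : rel T) (u w : T) :
  equivalence_rel e -> e u w -> class_weight p e u = class_weight p e w.
Proof.
move=> eqe uw; have /equivalence_relP[_ el] := eqe.
apply: eq_bigl => v; rewrite ![e v _](equivalence_rel_sym eqe).
exact: el.
Qed.

(* Apply [ln x <= x - 1] to the ratio [P1 P2 / (P12 P0)] of the weights of the
   classes of a point, whose mean is at most 1. *)
Lemma entropy_submodular (R : realType) (T : finType) (p : T -> R) (e0 e1 e2 e12 : rel T) :
  (forall w, 0 <= p w) ->
  equivalence_rel e0 -> equivalence_rel e1 -> equivalence_rel e2 ->
  subrel e1 e0 -> subrel e2 e0 ->
  (forall u w, e12 u w = e1 u w && e2 u w) ->
  \sum_w p w * ln (class_weight p e1 w) + \sum_w p w * ln (class_weight p e2 w) <=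
  \sum_w p w * ln (class_weight p e12 w) + \sum_w p w * ln (class_weight p e0 w).
Proof.
move=> p0 q0 q1 q2 s1 s2 e12E.
have s1' := equivalence_rel_sym q1; have s2' := equivalence_rel_sym q2.
have [r0 l0] := (equivalence_relP _).1 q0.
have [r1 l1] := (equivalence_relP _).1 q1; have [r2 l2] := (equivalence_relP _).1 q2.
have q12 : equivalence_rel e12.
  apply/equivalence_relP; split=> [x|x y + z]; rewrite !e12E; first by rewrite r1 r2.
  by case/andP=> xy1 xy2; rewrite (l1 _ _ xy1) (l2 _ _ xy2).
have r12 : reflexive e12 by move=> x; rewrite e12E r1 r2.
pose P e w := class_weight p e w.
pose r w := P e1 w * P e2 w / (P e12 w * P e0 w).
have main : \sum_w p w * r w <= \sum_w p w.
  have -> : \sum_w p w * r w =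
      \sum_u \sum_v \sum_(w | e1 u w && e2 v w) p w * (p u * p v / (P e12 w * P e0 w)).
    transitivity (\sum_w \sum_(u | e1 u w) \sum_(v | e2 v w)
       p w * (p u * p v / (P e12 w * P e0 w))).
      apply: eq_bigr => w _; rewrite /r {1}/P {1}/class_weight !mulr_suml mulr_sumr.
      apply: eq_bigr => u _; rewrite {1}/P {1}/class_weight mulr_sumr mulr_suml mulr_sumr.
      by [].
    rewrite (exchange_big_dep predT) //=; apply: eq_bigr => u _.
    by rewrite (exchange_big_dep predT) //=.
  (* For fixed [u] and [v] the points [w] form one class of [e12] or none. Both denominators are
     constant on it, and its total weight cancels [P e12] unless both are 0. *)
  have bound u v : \sum_(w | e1 u w && e2 v w) p w * (p u * p v / (P e12 w * P e0 w)) <=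
     if e0 v u then p v * (p u / P e0 u) else 0.
    have [w0 /andP[uw0 vw0]|none] := pickP (fun w => e1 u w && e2 v w); last first.
      rewrite big_pred0 //; case: ifP => // _.
      by rewrite mulr_ge0 // divr_ge0 // class_weight_ge0.
    have u0 := s1 _ _ uw0; have v0 := s2 _ _ vw0.
    rewrite (l0 _ _ v0) (equivalence_rel_sym q0) u0.
    have -> : \sum_(w | e1 u w && e2 v w) p w * (p u * p v / (P e12 w * P e0 w)) =
       P e12 w0 / P e12 w0 * (p v * (p u / P e0 u)).
      rewrite [X in _ = X / _ * _]/P {1}/class_weight !mulr_suml.
      apply: eq_big => [w|w /andP[uw vw]].
        by rewrite e12E (l1 _ _ uw0) (l2 _ _ vw0) (s1' w0) (s2' w0).
      have -> : P e12 w = P e12 w0.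
        apply: class_weight_eq => //.
        by rewrite e12E -(l1 _ _ uw) uw0 -(l2 _ _ vw) vw0.
      have -> : P e0 w = P e0 u.
        by apply: class_weight_eq => //; rewrite (equivalence_rel_sym q0) s1.
      by rewrite invfM; ring.
    rewrite ler_piMl //; first by rewrite mulr_ge0 // divr_ge0 // class_weight_ge0.
    have [->|P0] := eqVneq (P e12 w0) 0; first by rewrite mul0r ler01.
    by rewrite divff.
  apply: (@le_trans _ _ (\sum_u \sum_(v | e0 v u) p v * (p u / P e0 u))).
    by apply: ler_sum => u _; rewrite [leRHS]big_mkcond; apply: ler_sum => v _; apply: bound.
  apply: ler_sum => u _; rewrite -mulr_suml -/(class_weight p e0 u) -/(P e0 u).
  have [->|P0] := eqVneq (P e0 u) 0; first by rewrite mul0r.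
  by rewrite mulrCA divff // mulr1.
suff key w : p w * (ln (P e1 w) + ln (P e2 w) - ln (P e12 w) - ln (P e0 w)) <= p w * r w - p w.
  have : \sum_w p w * (ln (P e1 w) + ln (P e2 w) - ln (P e12 w) - ln (P e0 w)) <= 0.
    apply: le_trans (ler_sum _ (fun w _ => key w)) _.
    by rewrite sumrB subr_le0.
  under eq_bigr do rewrite !mulrDr !mulrN.
  by rewrite !big_split !sumrN /=; rewrite /P; lra.
have [->|] := eqVneq (p w) 0; first by rewrite !mul0r subr0.
move=> pn0; have pw : 0 < p w by rewrite lt_neqAle eq_sym pn0 p0.
have Pp e : reflexive e -> 0 < P e w by move=> re; apply: class_weight_gt0.
have P0p := Pp _ r0; have P1p := Pp _ r1; have P2p := Pp _ r2; have P12p := Pp _ r12.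
rewrite -{3}[p w]mulr1 -mulrBr ler_wpM2l //.
have rp : 0 < r w by rewrite /r divr_gt0 // mulr_gt0.
have -> : ln (P e1 w) + ln (P e2 w) - ln (P e12 w) - ln (P e0 w) = ln (r w).
  rewrite /r lnM ?posrE ?invr_gt0 ?mulr_gt0 // lnV ?posrE ?mulr_gt0 //.
  by rewrite !lnM ?posrE //; ring.
by have := @le_ln1Dx R (r w - 1); rewrite (addrC 1) subrK; apply; lra.
Qed.

Lemma restrict_eqP (n : nat) (D : 'I_n -> finType) (X : {set 'I_n})
    (u w : {dffun forall i : 'I_n, D i}) :
  reflect (forall i, i \in X -> u i = w i) (restrict X u == restrict X w).
Proof.
apply: (iffP eqP) => [e i iX|e].
  by have := congr1 (fun f : valuation D X => f (exist _ i iX)) e; rewrite !ffunE.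
by apply/ffunP => -[i iX]; rewrite !ffunE; apply: e.
Qed.

Lemma restrict_equivalence (n : nat) (D : 'I_n -> finType) (X : {set 'I_n}) :
  equivalence_rel [rel u w : {dffun forall i : 'I_n, D i} | restrict X u == restrict X w].
Proof.
by apply/equivalence_relP; split=> [x|x y /eqP xy z] /=; rewrite ?eqxx ?xy.
Qed.

Lemma restrict_subset (n : nat) (D : 'I_n -> finType) (X Y : {set 'I_n})
    (u w : {dffun forall i : 'I_n, D i}) :
  X \subset Y -> restrict Y u == restrict Y w -> restrict X u == restrict X w.
Proof. by move=> /subsetP XY /restrict_eqP e; apply/restrict_eqP => i /XY; apply: e. Qed.

Lemma restrictU (n : nat) (D : 'I_n -> finType) (X Y : {set 'I_n})
    (u w : {dffun forall i : 'I_n, D i}) :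
  (restrict (X :|: Y) u == restrict (X :|: Y) w) =
  (restrict X u == restrict X w) && (restrict Y u == restrict Y w).
Proof.
apply/idP/andP => [e|[/restrict_eqP eX /restrict_eqP eY]].
  by split; apply: restrict_subset e; rewrite ?subsetUl ?subsetUr.
by apply/restrict_eqP => i; rewrite inE => /orP[/eX|/eY].
Qed.

(** The weight of each value is spread over its fibre, so that entropies for different X are sums
    over the same points. *)
Lemma shannon_marginal (R : realType) (n : nat) (D : 'I_n -> finType)
    (p : {dffun forall i : 'I_n, D i} -> R) (X : {set 'I_n}) :
  shannon (marginal p (X := X)) = - \sum_w p w *
    log2 (class_weight p [rel u w | restrict X u == restrict X w] w).
Proof.
rewrite /shannon; congr (- _).
rewrite [RHS](partition_big (restrict X) predT) //=; apply: eq_bigr => t _.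
rewrite /marginal big_distrl /=; apply: eq_bigr => w /eqP wt.
by congr (_ * log2 _); apply: eq_bigl => u /=; rewrite wt.
Qed.

Lemma ln2_gt0 (R : realType) : 0 < ln 2 :> R.
Proof. by apply: ln_gt0; lra. Qed.

Lemma entropic_polymatroid (R : realType) (n : nat) (h : {set 'I_n} -> R) :
  entropic h -> polymatroid h.
Proof.
move=> [D [p [p0 p1 hE]]].
pose e (X : {set 'I_n}) := [rel u w : {dffun forall i : 'I_n, D i} | restrict X u ==
  restrict X w].
pose P X w := class_weight p (e X) w.
have {}hE X : h X = - (\sum_w p w * ln (P X w)) / ln 2.
  by rewrite hE shannon_marginal mulNr mulr_suml; congr (- _); apply: eq_bigr => w _;
    rewrite mulrA.
have l2 := ln2_gt0 R; have l2V : 0 <= (ln 2)^-1 :> R by rewrite invr_ge0 ltW.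
have eqe X : equivalence_rel (e X) := @restrict_equivalence n D X.
have re X : reflexive (e X) by move=> u; rewrite /= eqxx.
have Pmono (X Y : {set 'I_n}) w : X \subset Y -> P Y w <= P X w.
  move=> XY; rewrite /P /class_weight [leLHS]big_mkcond [leRHS]big_mkcond /=.
  apply: ler_sum => u _; case: ifP => [/(restrict_subset XY)->//|_].
  by case: ifP.
have hmono (X Y : {set 'I_n}) : X \subset Y -> h X <= h Y.
  move=> XY; rewrite !hE ler_wpM2r // lerN2; apply: ler_sum => w _.
  have [->|] := eqVneq (p w) 0; first by rewrite !mul0r.
  move=> pn0; have pw : 0 < p w by rewrite lt_neqAle eq_sym pn0 p0.
  by rewrite ler_wpM2l // ler_ln ?posrE ?class_weight_gt0 // Pmono.
have h0 : h set0 = 0.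
  rewrite hE big1 ?oppr0 ?mul0r // => w _.
  have -> : P set0 w = 1.
    by rewrite -p1; apply: eq_bigl => u; apply/restrict_eqP => i; rewrite inE.
  by rewrite ln1 mulr0.
split=> [X||X Y|X Y] //; first by rewrite -h0 hmono ?sub0set.
  by rewrite hmono ?subsetUl.
have s1 : subrel (e X) (e (X :&: Y)) by move=> u w; apply/restrict_subset/subsetIl.
have s2 : subrel (e Y) (e (X :&: Y)) by move=> u w; apply/restrict_subset/subsetIr.
have := entropy_submodular p0 (eqe _) (eqe _) (eqe _) s1 s2
  (e12 := e (X :|: Y)) (restrictU X Y).
by rewrite !hE -!mulrDl => le; rewrite ler_wpM2r // -!opprD lerN2.
Qed.

(* Each unit of weight of W is a fair bit, copied to the variables outside W. *)
Lemma entropic_step_sum (R : realType) (n : nat) (c : {set 'I_n} -> nat) :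
  entropic (fun X => \sum_(W : {set 'I_n} | W \proper setT) (c W)%:R * step R W X).
Proof.
pose T : finType := {W : {set 'I_n} & 'I_(c W)}.
pose B : finType := {ffun T -> bool}.
pose D (i : 'I_n) : finType := B.
pose F (b : B) : {dffun forall i : 'I_n, D i} :=
  [ffun i => [ffun t : T => b t && (i \notin tag t)]].
pose N : R := #|B|%:R.
have N0 : N != 0.
  by rewrite pnatr_eq0 -lt0n; apply/card_gt0P; exists [ffun=> true].
(* The image of the uniform law under [F], which need not be injective. *)
pose p w : R := \sum_(b | F b == w) N^-1.
have pE (f : _ -> R) : \sum_w p w * f w = \sum_b N^-1 * f (F b).
  rewrite [RHS](partition_big F predT) //=; apply: eq_bigr => w _.
  by rewrite /p mulr_suml; apply: eq_bigr => b /eqP->.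
have pE1 (P : pred _) : \sum_(w | P w) p w = \sum_(b | P (F b)) N^-1.
  rewrite big_mkcond [RHS]big_mkcond.
  transitivity (\sum_w p w * (P w)%:R); first by apply: eq_bigr => w _; case: (P w);
    rewrite ?mulr1 ?mulr0.
  by rewrite pE; apply: eq_bigr => b _; case: (P _); rewrite ?mulr1 ?mulr0.
exists D, p; split=> [w||X].
- by apply: sumr_ge0 => b _; rewrite invr_ge0 ler0n.
- by rewrite pE1 sumr_const -[X in X *+ _]mulr1 -mulrnAr mulVf.
rewrite shannon_marginal pE.
(* The number of bits visible from [X]. *)
pose m := #|[pred t : T | ~~ (X \subset tag t)]|.
have cw b : class_weight p [rel u w | restrict X u == restrict X w] (F b) = (2 ^+ m)^-1.
  rewrite /class_weight (pE1 (fun u => restrict X u == restrict X (F b))).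
  (* A class consists of the points that agree with [b] on the visible bits and are free on the
     others. *)
  pose G (t : T) : pred bool := if X \subset tag t then predT else pred1 (b t).
  rewrite (eq_bigl (mem (family G))) => [|b']; last first.
    apply/restrict_eqP/familyP => [e t|e i iX].
      rewrite /G; case: ifPn => // /subsetPn[i iX iW].
      have := e i iX; rewrite !ffunE => /ffunP/(_ t).
      by rewrite !ffunE iW !andbT => ->; rewrite inE.
    rewrite !ffunE; apply/ffunP => t; rewrite !ffunE.
    have := e t; rewrite /G; case: ifPn => [/subsetP/(_ i iX)->|_]; first by rewrite !andbF.
    by rewrite inE => /eqP->.
  rewrite sumr_const card_family -[X in X *+ _]mul1r -mulrnAl.
  have -> : N = 2 ^+ #|T| by rewrite /N card_ffun card_bool natrX.
  rewrite foldrE big_map big_enum /=.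
  have -> : (\prod_(t : T) #|G t|)%N = (2 ^ #|[pred t : T | X \subset tag t]|)%N.
    rewrite -prod_nat_const [RHS]big_mkcond; apply: eq_bigr => t _.
    by rewrite /G inE; case: ifP => _; [rewrite -card_bool; apply: eq_card|rewrite card1].
  rewrite natrX -(cardC [pred t : T | X \subset tag t]) exprD invfM mulrA divff ?mul1r //.
  by rewrite expf_neq0 // pnatr_eq0.
under [in RHS]eq_bigr do rewrite cw.
rewrite sumr_const -[X in - X]mulr_natl mulrA divff // mul1r.
rewrite /log2 lnV ?posrE ?exprn_gt0 // lnXn // mulNr opprK -[ln 2 *+ m]mulr_natl mulfK;
  last first.
  by rewrite gt_eqF // ln2_gt0.
rewrite /m -sum1_card natr_sum.
rewrite (eq_bigl (fun t : T => true && ~~ (X \subset tag t))) //.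
rewrite -(@sig_big_dep _ _ _ _ _ predT (fun (W : {set 'I_n}) (_ : 'I_(c W)) => ~~ (X
  \subset W)) (fun _ _ => 1)) /=.
rewrite big_mkcond; apply: eq_bigr => W _; rewrite /step properT.
(* Bits indexed by the full set are copied nowhere, which matches its absence from the sum over
   proper subsets. *)
have [->|_] := eqVneq W setT; first by rewrite /= big_pred0 // => i; rewrite subsetT.
rewrite /=; case: ifPn => XW; first by rewrite mulr0 big_pred0.
by rewrite sumr_const cardT size_enum_ord mulr1.
Qed.

(** * Transfer of validity *)

Lemma max_linear_ineqP (R : realType) (n k : nat) (q : R) (d : 'I_k.+1 -> coefs R n)
    (h : {set 'I_n} -> R) :
  max_linear_ineq q d h <-> exists l, q * h setT <= linear_expr (d l) h.
Proof.
rewrite /max_linear_ineq leNgt; split=> [/bigmax_ltP no|[l hl]].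
  apply: contrapT => no'; apply: no; split=> [|l _]; rewrite ltNge; apply/negP => le.
    by apply: no'; exists ord0.
  by apply: no'; exists l.
by apply/bigmax_ltP => -[_ /(_ l isT)]; rewrite ltNge hl.
Qed.

Lemma linear_expr_le (R : realType) (n : nat) (d : coefs R n) (g h : {set 'I_n} -> R) :
  conditional d ->
  (forall X Y : {set 'I_n}, X \subset Y -> 0 < d Y X -> cond g Y X <= cond h Y X) ->
  linear_expr d g <= linear_expr d h.
Proof.
move=> d0 gh; apply: ler_sum => X _; apply: ler_sum => Y XY.
have [->|dn0] := eqVneq (d Y X) 0; first by rewrite !mul0r.
have dp : 0 < d Y X by rewrite lt_neqAle eq_sym dn0 d0.
by rewrite ler_wpM2l ?gh // ltW.
Qed.

(** An expression that reaches the left side at [g] reaches the same left side at [h]. *)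
Lemma valid_on_minorant (R : realType) (n k : nat) (C C' : ({set 'I_n} -> R) -> Prop)
    (q : R) (d : 'I_k.+1 -> coefs R n) :
  (forall h, C' h -> exists2 g, C g &
     g setT = h setT /\ forall l, linear_expr (d l) g <= linear_expr (d l) h) ->
  valid_on C q d -> valid_on C' q d.
Proof.
move=> min v h /min[g Cg [gT le]]; apply/max_linear_ineqP.
have [l hl] := (max_linear_ineqP _ _ _).1 (v g Cg).
by exists l; rewrite -gT (le_trans hl).
Qed.

Lemma valid_on_sub (R : realType) (n k : nat) (C C' : ({set 'I_n} -> R) -> Prop)
    (q : R) (d : 'I_k.+1 -> coefs R n) :
  (forall h, C' h -> C h) -> valid_on C q d -> valid_on C' q d.
Proof. by move=> sub v h /sub /v. Qed.

Lemma valid_modular_polymatroid (R : realType) (n k : nat) (q : R) (d : 'I_k.+1 -> coefs R n) :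
  (forall l, conditional (d l)) -> (forall l, unconditioned (d l)) ->
  valid_on (@modular R n) q d -> valid_on (@polymatroid R n) q d.
Proof.
move=> dc du; apply: valid_on_minorant => h ph.
have [_ h0 _ _] := ph.
have eT : [set j : 'I_n | (j < n)%N] = setT by apply/setP => j; rewrite !inE ltn_ord.
have cle X : chain h X <= h X.
  by have [] := @chain_prefix R n h X n ph (leqnn n); rewrite eT setIT.
exists (chain h); first exact: chain_modular.
split=> [|l].
  by have [] := @chain_prefix R n h setT n ph (leqnn n); rewrite eT.
apply: linear_expr_le => // X Y XY /(du l _ _ XY)->.
by rewrite /cond set0U h0 [chain h set0]big_set0 !subr0.
Qed.

Lemma valid_normal_polymatroid (R : realType) (n k : nat) (q : R) (d : 'I_k.+1 -> coefs R n) :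
  (forall l, conditional (d l)) -> (forall l, simple (d l)) ->
  valid_on (@normal R n) q d -> valid_on (@polymatroid R n) q d.
Proof.
move=> dc ds; apply: valid_on_minorant => h ph; have [_ h0 _ _] := ph.
have [g ng [gle gT gs]] := normal_minorant ph; exists g => //; split=> // l.
apply: linear_expr_le => // X Y XY /(ds l _ _ XY) X1; rewrite /cond.
have -> : g X = h X; last by rewrite lerD2r.
move: X1; rewrite leq_eqVlt ltnS leqn0 cards_eq0 => /orP[/cards1P[i ->]|/eqP->] //.
by rewrite h0; have [_ ->] := normal_polymatroid ng.
Qed.

Lemma linear_expr_sum (R : realType) (n : nat) (d : coefs R n) (I : finType) (P : pred I)
    (c : I -> R) (h : I -> {set 'I_n} -> R) :
  linear_expr d (fun X => \sum_(i | P i) c i * h i X) =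
  \sum_(i | P i) c i * linear_expr d (h i).
Proof.
rewrite /linear_expr; under [RHS]eq_bigr do rewrite mulr_sumr.
rewrite exchange_big; apply: eq_bigr => X _ /=.
under [RHS]eq_bigr do rewrite mulr_sumr.
rewrite exchange_big; apply: eq_bigr => Y _ /=.
rewrite /cond -sumrB mulr_sumr; apply: eq_bigr => i _; ring.
Qed.

(** The step function of a proper subset is 1 on V, so its share of the left side is [q]. *)
Lemma deficit_step_sum (R : realType) (n : nat) (q : R) (d : coefs R n) (c : {set 'I_n} -> R)
    (h : {set 'I_n} -> R) :
  (forall X, h X = \sum_(W : {set 'I_n} | W \proper setT) c W * step R W X) ->
  q * h setT - linear_expr d h =
  \sum_(W : {set 'I_n} | W \proper setT) c W * (q - linear_expr d (step R W)).
Proof.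
move=> /funext->; rewrite linear_expr_sum mulr_sumr -sumrB; apply: eq_bigr => W.
by rewrite properE => /andP[_ /negPf WT]; rewrite /step WT; ring.
Qed.

Definition step_violation (R : realType) (n k : nat) (q : R) (d : 'I_k.+1 -> coefs R n)
    (c : {set 'I_n} -> nat) : Prop :=
  forall l, 0 < \sum_(W : {set 'I_n} | W \proper setT)
    (c W)%:R * (q - linear_expr (d l) (step R W)).

Lemma step_violation_entropic (R : realType) (n k : nat) (q : R) (d : 'I_k.+1 -> coefs R n)
    (c : {set 'I_n} -> nat) :
  step_violation q d c -> ~ valid_on (@entropic R n) q d.
Proof.
move=> vc /(_ _ (entropic_step_sum R c)) /max_linear_ineqP[l].
by rewrite -subr_le0 (deficit_step_sum _ _ (fun=> erefl)) leNgt vc.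
Qed.

Lemma valid_normalP (R : realType) (n k : nat) (q : R) (d : 'I_k.+1 -> coefs R n) :
  (forall c, ~ step_violation q d c) -> valid_on (@normal R n) q d.
Proof.
move=> no h [c [c0 hE]]; apply/max_linear_ineqP; apply: contrapT => nl.
have [l|m mv] := @nat_approximation R 'I_k.+1 _ (fun W : {set 'I_n} => W \proper setT)
    (fun l W => q - linear_expr (d l) (step R W)) c c0; last exact: (no m).
rewrite -(deficit_step_sum _ _ hE) subr_gt0 ltNge; apply/negP => le.
by apply: nl; exists l.
Qed.

(** Closes the cycle: entropic validity excludes step violations, which gives normal, then
    polymatroid, then again entropic validity. *)
Lemma valid_entropicP (R : realType) (n k : nat) (q : R) (d : 'I_k.+1 -> coefs R n) :
  (forall l, conditional (d l)) -> (forall l, simple (d l)) ->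
  valid_on (@entropic R n) q d <-> forall c, ~ step_violation q d c.
Proof.
move=> dc ds; split=> [v c /step_violation_entropic //|no].
apply: (valid_on_sub (@entropic_polymatroid R n)).
exact/valid_normal_polymatroid/valid_normalP.
Qed.

Lemma valid_on_equivalences (R : realType) (n k : nat) (q : R) (d : 'I_k.+1 -> coefs R n) :
  (forall l, conditional (d l)) ->
  [/\ (forall l, unconditioned (d l)) ->
        (valid_on (@modular R n) q d <-> valid_on (@polymatroid R n) q d),
      (forall l, simple (d l)) ->
        (valid_on (@normal R n) q d <-> valid_on (@polymatroid R n) q d) &
      (forall l, simple (d l)) ->
        (valid_on (@entropic R n) q d <-> valid_on (@polymatroid R n) q d)].
Proof.
move=> dc; split=> [du|ds|ds]; split.
- exact: valid_modular_polymatroid.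
- exact/valid_on_sub/modular_polymatroid.
- exact: valid_normal_polymatroid.
- exact/valid_on_sub/normal_polymatroid.
- by move=> /(valid_entropicP _ dc ds) /valid_normalP /(valid_normal_polymatroid dc ds).
- exact/valid_on_sub/entropic_polymatroid.
Qed.

(** * Recursive functions *)

Local Open Scope nat_scope.

(* Functions of an environment of unspecified length, so that a binder merely
   conses its variable onto the environment. *)
Definition computable (f : seq nat -> nat) : Prop :=
  forall k, recursive (fun v : k.-tuple nat => f v).

Lemma recursive_ext k (f g : k.-tuple nat -> nat) :
  recursive f -> f =1 g -> recursive g.
Proof. by move=> rf /funext <-. Qed.

Lemma computable_const c : computable (fun=> c).
Proof.
move=> k; elim: c => [|c IH]; first exact: recursive_zero.
by apply: (recursive_comp (f := fun _ _ => c) recursive_succ) => // v; rewrite tnth_mktuple.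
Qed.

Lemma computable_nth i : computable (fun s => nth 0 s i).
Proof.
move=> k; have [ik|ki] := ltnP i k; last first.
  apply: (recursive_ext (computable_const 0 k)) => v.
  by rewrite nth_default // size_tuple.
apply: (recursive_ext (recursive_proj (Ordinal ik))) => v.
by rewrite (tnth_nth 0).
Qed.

Lemma computable_drop f j : computable f -> computable (fun s => f (drop j s)).
Proof.
move=> cf k.
apply: (recursive_comp (f := fun (i : 'I_(k - j)) (v : k.-tuple nat) =>
  nth 0 v (j + i)) (cf (k - j))) => [i|v]; first exact: computable_nth.
congr f; apply: (@eq_from_nth _ 0) => [|i]; rewrite size_drop ?size_tuple // => ilt.
by rewrite nth_drop -[i]/(nat_of_ord (Ordinal ilt)) -tnth_nth tnth_mktuple.
Qed.

(** Substitution for the variable at the head of the environment. The offset [j] discards what an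
    enclosing binder has pushed; it is 2 under a primitive recursion, which pushes the counter and
    the previous value. *)
Lemma computable_let (F : nat -> seq nat -> nat) a j :
  computable (fun s => F (nth 0 s 0) (drop 1 s)) -> computable a ->
  computable (fun s => F (a s) (drop j s)).
Proof.
move=> cF ca k.
apply: (recursive_comp (f := fun (i : 'I_(k - j).+1) (v : k.-tuple nat) =>
  nth 0 (a v :: drop j v) i) (cF (k - j).+1)) => [[[|i] Hi]|v].
- exact: ca.
- exact: (computable_drop j (computable_nth i)).
have -> : [tuple nth 0 (a v :: drop j v) i | i < (k - j).+1] = [tuple of a v :: drop_tuple
  j v].
  by apply: eq_from_tnth => i; rewrite tnth_mktuple (tnth_nth 0).
by rewrite /= drop0.
Qed.

Lemma computable_rec (h : nat -> seq nat -> nat) f G g :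
  computable f -> computable G -> computable g ->
  (forall s, h 0 s = f s) -> (forall x s, h x.+1 s = G [:: x, h x s & s]) ->
  computable (fun s => h (g s) s).
Proof.
move=> cf cG cg h0 hS k.
have rh : recursive (fun v : k.+1.-tuple nat => h (head 0 v) (behead v)).
  apply: (recursive_prim (cf k) (cG k.+2)) => [v|x v]; first by rewrite /= h0.
  by rewrite /= hS.
apply: (recursive_comp (f := fun (i : 'I_k.+1) (v : k.-tuple nat) =>
   nth 0 (g v :: v) i) rh) => [[[|i] Hi]|v]; [exact: cg|exact: computable_nth|].
have -> : [tuple nth 0 (g v :: v) i | i < k.+1] = [tuple of g v :: v].
  by apply: eq_from_tnth => i; rewrite tnth_mktuple (tnth_nth 0).
by [].
Qed.

Lemma computable_succ f : computable f -> computable (fun s => (f s).+1).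
Proof.
move=> cf k; apply: (recursive_comp (f := fun _ (v : k.-tuple nat) => f v) recursive_succ)
  => [_|v].
  exact: cf.
by rewrite tnth_mktuple.
Qed.

Lemma computable_iter (F : nat -> seq nat -> nat) f g :
  computable (fun s => F (nth 0 s 0) (drop 1 s)) -> computable f -> computable g ->
  computable (fun s => iter (g s) (fun x => F x s) (f s)).
Proof.
move=> cF cf cg.
apply: (@computable_rec (fun x s => iter x (fun x => F x s) (f s)) f
  (fun s => F (nth 0 s 1) (drop 2 s)) g) => //.
- exact/(computable_let 2 cF)/computable_nth.
- by move=> x s /=; rewrite drop0.
Qed.

Lemma computable_add f g :
  computable f -> computable g -> computable (fun s => f s + g s).
Proof.
move=> cf cg.
apply: (@computable_rec (fun x s => f s + x) f (fun s => (nth 0 s 1).+1) g) => //.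
- exact/computable_succ/computable_nth.
- by move=> s; rewrite addn0.
- by move=> x s; rewrite addnS.
Qed.

Lemma computable_sum (F : nat -> seq nat -> nat) g :
  computable (fun s => F (nth 0 s 0) (drop 1 s)) -> computable g ->
  computable (fun s => \sum_(i < g s) F i s).
Proof.
move=> cF cg.
apply: (@computable_rec (fun x s => \sum_(i < x) F i s) (fun=> 0)
  (fun s => nth 0 s 1 + F (nth 0 s 0) (drop 2 s)) g) => //.
- exact: computable_const.
- apply: computable_add; first exact: computable_nth.
  exact/(computable_let 2 cF)/computable_nth.
- by move=> s; rewrite big_ord0.
- by move=> x s; rewrite big_ord_recr /= drop0.
Qed.

Lemma computable_mul f g :
  computable f -> computable g -> computable (fun s => f s * g s).
Proof.
move=> cf cg; apply: (@computable_rec (fun x s => f s * x) (fun=> 0)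
  (fun s => f (drop 2 s) + nth 0 s 1) g) => //.
- exact: computable_const.
- by apply: computable_add; [apply: computable_drop|apply: computable_nth].
- by move=> s; rewrite muln0.
- by move=> x s; rewrite /= drop0 mulnS.
Qed.

Lemma computable_exp f g :
  computable f -> computable g -> computable (fun s => f s ^ g s).
Proof.
move=> cf cg; apply: (@computable_rec (fun x s => f s ^ x) (fun=> 1)
  (fun s => f (drop 2 s) * nth 0 s 1) g) => //.
- exact: computable_const.
- by apply: computable_mul; [apply: computable_drop|apply: computable_nth].
- by move=> x s; rewrite /= drop0 expnS.
Qed.

Lemma computable_pred f : computable f -> computable (fun s => (f s).-1).
Proof.
move=> cf; apply: (@computable_rec (fun x _ => x.-1) (fun=> 0)
  (fun s => nth 0 s 0) f) => //; [exact: computable_const|exact: computable_nth].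
Qed.

Lemma computable_sub f g :
  computable f -> computable g -> computable (fun s => f s - g s).
Proof.
move=> cf cg; apply: (@computable_rec (fun x s => f s - x) f
  (fun s => (nth 0 s 1).-1) g) => //.
- exact/computable_pred/computable_nth.
- by move=> s; rewrite subn0.
- by move=> x s; rewrite subnS.
Qed.

Lemma computable_not (b : seq nat -> bool) : computable (fun s => b s) -> computable (fun s
  => ~~ b s).
Proof.
move=> cb k; apply: (recursive_ext (computable_sub (computable_const 1) cb k)) => v.
by case: (b v).
Qed.

Lemma computable_and (b c : seq nat -> bool) :
  computable (fun s => b s) -> computable (fun s => c s) ->
  computable (fun s => b s && c s).
Proof.
move=> cb cc k; apply: (recursive_ext (computable_mul cb cc k)) => v.
by rewrite mulnb.
Qed.

Lemma computable_eq0 f : computable f -> computable (fun s => f s == 0).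
Proof.
move=> cf k; apply: (recursive_ext (computable_sub (computable_const 1) cf k)) => v.
by case: (f v : nat).
Qed.

Lemma computable_or (b c : seq nat -> bool) :
  computable (fun s => b s) -> computable (fun s => c s) ->
  computable (fun s => b s || c s).
Proof.
move=> cb cc k; apply: (recursive_ext (computable_not (computable_and (computable_not cb)
  (computable_not cc)) k)) => v.
by rewrite negb_and !negbK.
Qed.

Lemma computable_leq f g :
  computable f -> computable g -> computable (fun s => f s <= g s).
Proof. by move=> cf cg; apply/computable_eq0/computable_sub. Qed.

Lemma computable_ltn f g :
  computable f -> computable g -> computable (fun s => f s < g s).
Proof. by move=> cf cg; apply: computable_leq => //; apply: computable_succ. Qed.

Lemma computable_forall (b : nat -> seq nat -> bool) g :
  computable (fun s => b (nth 0 s 0) (drop 1 s)) -> computable g ->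
  computable (fun s => [forall i : 'I_(g s), b i s]).
Proof.
move=> cb cg k.
have := computable_eq0 (computable_sum (F := fun i s => ~~ b i s) (computable_not cb) cg).
move=> /(_ k) /recursive_ext; apply => v.
rewrite sum_nat_eq0; congr nat_of_bool; apply: eq_forallb => i.
by case: (b i v).
Qed.

(** Counting the positive multiples of [d] up to [m] turns division into a bounded sum. *)
Lemma divn_sum m d : 0 < d -> m %/ d = \sum_(i < m) (i.+1 * d <= m).
Proof.
move=> d0; under eq_bigr do rewrite -leq_divRL //.
have : m %/ d <= m by exact: leq_div.
elim: m (m %/ d) => [|m IH] q; first by rewrite leqn0 => /eqP->; rewrite big_ord0.
rewrite leq_eqVlt ltnS big_ord_recr /= => /predU1P[->|qm]; last first.
  by rewrite -(IH _ qm) ltnNge qm addn0.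
rewrite ltnSn addn1; congr S.
rewrite (eq_bigr (fun=> 1)) => [|i _]; last by rewrite ltnS ltnW.
by rewrite sum1_card card_ord.
Qed.

Lemma computable_div f g :
  computable f -> computable g -> computable (fun s => f s %/ g s).
Proof.
move=> cf cg k.
pose c s := \sum_(i < f s) (i.+1 * g s <= f s).
have cc : computable c.
  apply: (@computable_sum (fun i s => i.+1 * g s <= f s)) => //.
  apply: computable_leq; last exact: computable_drop.
  by apply: computable_mul; [apply/computable_succ/computable_nth|apply: computable_drop].
(* For a zero divisor the count is [f s] while [%/] gives 0; this factor corrects it. *)
have cg0 := computable_not (computable_eq0 cg).
apply: (recursive_ext (computable_mul cg0 cc k)) => v.
have [->|] := posnP (g v); first by rewrite divn0.
by move=> g0; rewrite mul1n divn_sum.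
Qed.

Lemma computable_odd f : computable f -> computable (fun s => odd (f s)).
Proof.
move=> cf k.
have c2 := computable_div cf (computable_const 2).
apply: (recursive_ext (computable_sub cf (computable_mul c2 (computable_const 2)) k)) => v.
by rewrite -modn2 {1}(divn_eq (f v) 2) addKn.
Qed.

Lemma computable_mod f g :
  computable f -> computable g -> computable (fun s => f s %% g s).
Proof.
move=> cf cg k.
apply: (recursive_ext (computable_sub cf (computable_mul (computable_div cf cg) cg) k)) => v.
by rewrite {1}(divn_eq (f v) (g v)) addKn.
Qed.

Lemma logn_sum p m : prime p -> logn p m = \sum_(i < m) (m %% p ^ i.+1 == 0).
Proof.
move=> pp; have [->|m0] := posnP m; first by rewrite logn0 big_ord0.
rewrite logn_count_dvd // big_add1 /= big_mkord.
(* The sum has one exponent more than [logn_count_dvd], namely [m] itself, and p^m > m divides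
   nothing here. *)
case: m m0 => // m _ /=; rewrite big_ord_recr /= [X in _ + X](_ : _ = 0) ?addn0 //.
by rewrite modn_small // ltn_expl // prime_gt1.
Qed.

Lemma computable_logn2 f : computable f -> computable (fun s => logn 2 (f s)).
Proof.
move=> cf k.
have cd : computable (fun s => (f (drop 1 s)) %% 2 ^ (nth 0 s 0).+1 == 0).
  apply/computable_eq0/computable_mod; first exact: computable_drop.
  by apply: computable_exp; [exact: computable_const|apply/computable_succ/computable_nth].
apply: (recursive_ext (@computable_sum (fun i s => f s %% 2 ^ i.+1 == 0) f cd cf k)) => v.
by rewrite logn_sum.
Qed.

(** A sequence with head a and tail s has code 2^a (2 c + 1), where c is the code of s: the head is
    the 2-adic valuation and two divisions recover c. *)
Definition code_tail (x : nat) : nat := x %/ 2 ^ logn 2 x %/ 2.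

Definition code_nth (x i : nat) : nat := logn 2 (iter i code_tail x).

Lemma code_nthE s i : code_nth (CodeSeq.code s) i = nth 0 s i.
Proof.
rewrite /code_nth; elim: s i => [|a s IH] i /=.
  (* The empty sequence has code 0, a fixed point of [code_tail] with valuation 0 by convention, in
     accordance with the default of [nth]. *)
  by rewrite nth_nil; elim: i => // i IH; rewrite iterSr.
have la : logn 2 (2 ^ a * (CodeSeq.code s).*2.+1) = a.
  by rewrite lognM ?expn_gt0 // lognX logn_prime // muln1 lognE /= dvdn2 /= odd_double addn0.
case: i => [|i]; first by rewrite /= la.
rewrite iterSr [nth _ _ _]/= -IH; congr (logn 2 (iter i code_tail _)).
by rewrite /code_tail la mulKn ?expn_gt0 // divn2 -addn1 addnC (half_bit_double _ true).
Qed.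

Lemma computable_code_nth f g :
  computable f -> computable g -> computable (fun s => code_nth (f s) (g s)).
Proof.
move=> cf cg; apply: computable_logn2.
apply: (@computable_iter (fun x _ => code_tail x)) => //.
apply: computable_div; last exact: computable_const.
apply: computable_div; first exact: computable_nth.
apply: computable_exp; first exact: computable_const.
exact/computable_logn2/computable_nth.
Qed.

Lemma computable_mu (g : nat -> seq nat -> nat) :
  computable (fun s => g (nth 0 s 0) (drop 1 s)) ->
  forall g0 : forall s, exists z, g z s == 0,
  computable (fun s => ex_minn (g0 s)).
Proof.
move=> cg g0 k; apply: (recursive_mu (cg k.+1)) => [v|v y /= ylt].
  by case: ex_minnP => z /eqP gz _ /=; rewrite drop0.
rewrite drop0 => gy; move: ylt; case: ex_minnP => z _ /(_ y).
by rewrite gy eqxx => /(_ isT); rewrite leqNgt => /negP.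
Qed.

(** * The decision procedure *)

Lemma eq_from_bits n a b : a < 2 ^ n -> b < 2 ^ n ->
  (forall i, i < n -> odd (a %/ 2 ^ i) = odd (b %/ 2 ^ i)) -> a = b.
Proof.
elim: n a b => [|n IH] a b; first by rewrite expn0 !ltnS !leqn0 => /eqP-> /eqP->.
rewrite expnS => an bn e.
have e0 : odd a = odd b by have := e 0 isT; rewrite !divn1.
suff eh : a %/ 2 = b %/ 2 by rewrite -[a]odd_double_half -[b]odd_double_half e0 -!divn2 eh.
apply: IH => [||i ilt]; rewrite ?ltn_divLR // 1?[_ * 2]mulnC //.
by have := e i.+1 ilt; rewrite expnS !divnMA.
Qed.

Lemma bits_bij n : bijective (fun a : 'I_(2 ^ n) => bits n a).
Proof.
apply: inj_card_bij => [a b e|];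
  last by rewrite -cardsT -powersetT card_powerset cardsT !card_ord.
apply/val_inj/(eq_from_bits (ltn_ord a) (ltn_ord b)) => i ilt.
by have /setP/(_ (Ordinal ilt)) := e; rewrite !inE.
Qed.

Lemma bits_full n : bits n (2 ^ n).-1 = setT.
Proof.
apply/setP => i; rewrite !inE.
(* The quotient by 2^i is then 2^(n-i) - 1, which is odd. *)
have -> : (2 ^ n).-1 = ((2 ^ (n - i)).-1) * 2 ^ i + (2 ^ i).-1.
  have e : 2 ^ n = 2 ^ (n - i) * 2 ^ i by rewrite -expnD subnK // ltnW.
  have : 0 < 2 ^ (n - i) by rewrite expn_gt0.
  have : 0 < 2 ^ i by rewrite expn_gt0.
  rewrite e; nia.
rewrite divnMDl ?expn_gt0 // divn_small ?addn0 ?prednK ?expn_gt0 //.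
have -> : n - i = (n - i).-1.+1 by rewrite prednK // subn_gt0.
have : 0 < 2 ^ (n - i).-1 by rewrite expn_gt0.
by rewrite expnS; case: (2 ^ _) => // m _; rewrite mulnS /= mul2n odd_double.
Qed.

Lemma sum_bits n (F : {set 'I_n} -> nat) : \sum_X F X = \sum_(a < 2 ^ n) F (bits n a).
Proof. by rewrite (reindex _ (onW_bij _ (bits_bij n))). Qed.

(** The full set has the last index, so the proper subsets fill an initial segment. *)
Lemma sum_bits_proper n (F : {set 'I_n} -> nat) :
  \sum_(X : {set 'I_n} | X \proper setT) F X = \sum_(a < (2 ^ n).-1) F (bits n a).
Proof.
rewrite big_mkcond sum_bits.
have e : 2 ^ n = (2 ^ n).-1.+1 by rewrite prednK ?expn_gt0.
rewrite -(big_mkord predT (fun a => if bits n a \proper setT then F (bits n a) else 0)) {1}e.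
rewrite big_nat_recr //= bits_full properT eqxx addn0 big_mkord.
apply: eq_bigr => a _; rewrite properT -bits_full; case: eqP => // ba.
have alt : a < 2 ^ n by apply: ltn_trans (ltn_ord a) _; rewrite {2}e.
have flt : (2 ^ n).-1 < 2 ^ n by rewrite {2}e.
have /(bij_inj (bits_bij n)) : bits n (Ordinal alt) = bits n (Ordinal flt) by [].
by move/(congr1 val) => /= ea; have := ltn_ord a; rewrite {1}ea ltnn.
Qed.

Lemma nth_flatten_uniform (T I : Type) (x0 : T) (i0 : I) (F : I -> seq T) (r : seq I) N i j :
  (forall i, size (F i) = N) -> i < size r -> j < N ->
  nth x0 (flatten [seq F i | i <- r]) (i * N + j) = nth x0 (F (nth i0 r i)) j.
Proof.
move=> sF; elim: r i => // a r IH [|i] /= ilt jlt; rewrite nth_cat sF.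
  by rewrite mul0n add0n jlt.
rewrite mulSn -addnA ltnNge leq_addr /= addKn; exact: IH.
Qed.

Definition subset_bits (n a b : nat) : bool :=
  [forall i : 'I_n, ~~ (odd (a %/ 2 ^ i) && ~~ odd (b %/ 2 ^ i))].

Lemma subset_bitsE n a b : subset_bits n a b = (bits n a \subset bits n b).
Proof.
apply/forallP/subsetP => [s i|s i].
  by have := s i; rewrite !inE negb_and negbK; case: (odd _).
by have := s i; rewrite !inE negb_and negbK; case: (odd _) => //= ->.
Qed.

(* Below, x is the code of an inequality, and a set is represented by its index
   in binary order; w is the index of the set of a step function. *)
Definition code_entry (x l a b : nat) : nat :=
  code_nth x (3 + ((l * 2 ^ code_nth x 0 + a) * 2 ^ code_nth x 0 + b)).

(** For X included in Y, the step function of W gives h(Y|X) the value 1 if W contains X but not Y,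
    and 0 otherwise; here [a] stands for X and [b] for Y. *)
Definition code_cond (x l w a b : nat) : nat :=
  (subset_bits (code_nth x 0) a b && (subset_bits (code_nth x 0) a w
     && ~~ subset_bits (code_nth x 0) b w)) * code_entry x l a b.

Definition code_expr (x l w : nat) : nat :=
  \sum_(a < 2 ^ code_nth x 0) \sum_(b < 2 ^ code_nth x 0) code_cond x l w a b.

(** [z] lists weights of step functions that violate the inequality; terms are moved across to avoid
    subtraction. *)
Definition primal (x z : nat) : bool :=
  [forall l : 'I_(code_nth x 2),
    \sum_(w < (2 ^ code_nth x 0).-1) code_nth z w * code_expr x l w <
    (\sum_(w < (2 ^ code_nth x 0).-1) code_nth z w) * code_nth x 1].

(** [z] lists multipliers of the expressions, not all zero, whose combination of the rows of the
    primal system is nowhere positive. *)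
Definition dual (x z : nat) : bool :=
  (0 < \sum_(l < code_nth x 2) code_nth z l) &&
  [forall w : 'I_((2 ^ code_nth x 0).-1),
    (\sum_(l < code_nth x 2) code_nth z l) * code_nth x 1 <=
    \sum_(l < code_nth x 2) code_nth z l * code_expr x l w].

(** Weak duality: the bilinear form in weights and multipliers is bounded below by the dual
    inequalities and above by the primal ones, strictly at [l0], whose multiplier is positive. *)
Lemma dual_not_primal x y z : dual x y -> ~~ primal x z.
Proof.
move=> /andP[y0 /forallP yP]; apply/negP => /forallP zP.
have := y0; rewrite lt0n sum_nat_eq0 => /forallPn[l0 /= l0P].
pose M := (2 ^ code_nth x 0).-1; pose K := code_nth x 2.
have : \sum_(l < K) code_nth y l * (\sum_(w < M) code_nth z w * code_expr x l w) <
    \sum_(l < K) code_nth y l * ((\sum_(w < M) code_nth z w) * code_nth x 1).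
  rewrite [ltnLHS](bigD1 l0) //= [ltnRHS](bigD1 l0) //= -addSn leq_add //.
    by rewrite ltn_pmul2l ?zP // lt0n.
  by apply: leq_sum => l _; rewrite leq_mul2l (ltnW (zP l)) orbT.
rewrite ltnNge => /negP; apply.
rewrite -big_distrl /= mulnC -mulnA big_distrl /=.
under [leqRHS]eq_bigr do rewrite big_distrr.
rewrite exchange_big; apply: leq_sum => w _ /=.
under [leqRHS]eq_bigr do rewrite mulnCA.
by rewrite -big_distrr leq_mul2l mulnC yP orbT.
Qed.

Lemma nth_code_mkseq (f : nat -> nat) n i :
  i < n -> code_nth (CodeSeq.code (mkseq f n)) i = f i.
Proof. by move=> ilt; rewrite code_nthE nth_mkseq. Qed.

Lemma sum_deficit (R : pzRingType) (I : finType) (P : pred I) (u e : I -> nat) (q : nat) :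
  (\sum_(i | P i) (u i)%:R * (q%:R - (e i)%:R) =
   ((\sum_(i | P i) u i) * q)%:R - (\sum_(i | P i) u i * e i)%:R :> R)%R.
Proof.
rewrite big_distrl /= !natr_sum -sumrB; apply: eq_bigr => i _.
by rewrite !natrM mulrBr.
Qed.

Lemma primal_or_dual x : exists z, primal x z || dual x z.
Proof.
pose M := (2 ^ code_nth x 0).-1; pose K := code_nth x 2.
pose a (i : 'I_K) (j : nat) : int := ((code_nth x 1)%:Z - (code_expr x i j)%:Z)%R.
have [[c c0 Hc]|[v cv v0]] := ville M predT a.
  have [i||m Hm] := @nat_approximation rat 'I_K 'I_M predT (fun i j => (a i j)%:~R%R) c.
  - by move=> _; apply: c0.
  - by move=> i; apply: Hc.
  pose m' j := if insub j is Some j' then m j' else 0.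
  exists (CodeSeq.code (mkseq m' M)); apply/orP; left; apply/forallP => l.
  have mE (j : 'I_M) : code_nth (CodeSeq.code (mkseq m' M)) j = m j.
    by rewrite nth_code_mkseq // /m' insubT //= => jlt; congr m; apply: val_inj.
  have := Hm l; under eq_bigr do rewrite rmorphB /= -!pmulrn -mE.
  by rewrite sum_deficit subr_gt0 ltr_nat.
have [l [i _ li] e] := cone_coef cv.
pose l' j := if insub j is Some j' then l j' else 0.
exists (CodeSeq.code (mkseq l' K)); apply/orP; right.
have lE (j : 'I_K) : code_nth (CodeSeq.code (mkseq l' K)) j = l j.
  by rewrite nth_code_mkseq // /l' insubT //= => jlt; congr l; apply: val_inj.
apply/andP; split; first by rewrite (bigD1 i) //= lE addn_gt0 li.
apply/forallP => w; have := v0 w (ltn_ord w); rewrite e.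
under eq_bigr do rewrite -lE /a -!natz.
by rewrite sum_deficit subr_le0 ler_nat.
Qed.

Definition decide (x : nat) : bool := ~~ primal x (ex_minn (primal_or_dual x)).

(** If the certificate found is not primal, it is dual and excludes every primal one. *)
Lemma decideP x : decide x <-> forall z, ~~ primal x z.
Proof.
rewrite /decide; case: ex_minnP => y xy _; split=> [np z|]; last exact.
by move: xy; rewrite (negPf np) => /dual_not_primal.
Qed.

(** * Computability of the decision procedure *)

Lemma computable_subset_bits n a b :
  computable n -> computable a -> computable b ->
  computable (fun s => subset_bits (n s) (a s) (b s)).
Proof.
move=> cn ca cb.
have co f : computable f -> computable (fun s => odd (f (drop 1 s) %/ 2 ^ nth 0 s 0)).
  move=> cf; apply/computable_odd/computable_div; first exact: computable_drop.
  by apply: computable_exp; [exact: computable_const|exact: computable_nth].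
apply: (@computable_forall (fun i s => ~~ (odd (a s %/ 2 ^ i) && ~~ odd (b s %/ 2 ^ i))))
  => //.
by apply/computable_not/computable_and; [exact: co|apply/computable_not/co].
Qed.

Lemma computable_code_size x : computable x -> computable (fun s => 2 ^ code_nth (x s) 0).
Proof.
move=> cx; apply: computable_exp; first exact: computable_const.
by apply: computable_code_nth => //; exact: computable_const.
Qed.

Lemma computable_code_cond x l w a b :
  computable x -> computable l -> computable w -> computable a -> computable b ->
  computable (fun s => code_cond (x s) (l s) (w s) (a s) (b s)).
Proof.
move=> cx cl cw ca cb.
have cn : computable (fun s => code_nth (x s) 0).
  by apply: computable_code_nth => //; exact: computable_const.
have cN := computable_code_size cx.
apply: computable_mul.
  apply: computable_and; first exact: computable_subset_bits.
  by apply: computable_and; [|apply: computable_not]; apply: computable_subset_bits.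
apply: computable_code_nth => //; apply: computable_add; first exact: computable_const.
by do 2![apply: computable_add => //; apply: computable_mul => //].
Qed.

Lemma computable_code_expr x l w :
  computable x -> computable l -> computable w ->
  computable (fun s => code_expr (x s) (l s) (w s)).
Proof.
move=> cx cl cw; have cN := computable_code_size cx.
have inner x' l' w' a : computable x' -> computable l' -> computable w' -> computable a ->
   computable (fun s => \sum_(b < 2 ^ code_nth (x' s) 0) code_cond (x' s) (l' s) (w' s) (a
     s) b).
  move=> cx' cl' cw' ca.
  apply: (@computable_sum (fun b s => code_cond (x' s) (l' s) (w' s) (a s) b));
    last exact: computable_code_size.
  by apply: computable_code_cond; solve [exact: computable_nth|exact: computable_drop].
apply: (@computable_sum (fun a s => \sum_(b < 2 ^ code_nth (x s) 0) code_cond (x s) (l s)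
  (w s) a b)) => //.
by apply: inner; solve [exact: computable_nth|exact: computable_drop].
Qed.

Lemma computable_primal x z :
  computable x -> computable z -> computable (fun s => primal (x s) (z s)).
Proof.
move=> cx cz.
have c0 := computable_const 0; have c1 := computable_const 1; have c2 := computable_const 2.
have inner x' z' l : computable x' -> computable z' -> computable l ->
   computable (fun s => \sum_(w < (2 ^ code_nth (x' s) 0).-1) code_nth (z' s) w * code_expr
     (x' s) (l s) w <
     (\sum_(w < (2 ^ code_nth (x' s) 0).-1) code_nth (z' s) w) * code_nth (x' s) 1).
  move=> cx' cz' cl.
  have cM := computable_pred (computable_code_size cx').
  have cW : computable (fun s => code_nth (z' (drop 1 s)) (nth 0 s 0)).
    by apply: computable_code_nth; [exact: computable_drop|exact: computable_nth].
  apply: computable_ltn.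
    apply: (@computable_sum (fun w s => code_nth (z' s) w * code_expr (x' s) (l s) w)) => //.
    apply: computable_mul => //.
    by apply: computable_code_expr; solve [exact: computable_nth|exact: computable_drop].
  apply: computable_mul; last exact: computable_code_nth.
  exact: (@computable_sum (fun w s => code_nth (z' s) w)).
apply: (@computable_forall (fun l s => \sum_(w < (2 ^ code_nth (x s) 0).-1) code_nth (z s)
  w * code_expr (x s) l w <
     (\sum_(w < (2 ^ code_nth (x s) 0).-1) code_nth (z s) w) * code_nth (x s) 1)).
  by apply: inner; solve [exact: computable_nth|exact: computable_drop].
exact: computable_code_nth.
Qed.

Lemma computable_dual x z :
  computable x -> computable z -> computable (fun s => dual (x s) (z s)).
Proof.
move=> cx cz.
have c0 := computable_const 0; have c1 := computable_const 1; have c2 := computable_const 2.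
have total x' z' : computable x' -> computable z' ->
    computable (fun s => \sum_(l < code_nth (x' s) 2) code_nth (z' s) l).
  move=> cx' cz'; apply: (@computable_sum (fun l s => code_nth (z' s) l));
    last exact: computable_code_nth.
  by apply: computable_code_nth; [exact: computable_drop|exact: computable_nth].
have inner x' z' w : computable x' -> computable z' -> computable w ->
   computable (fun s => (\sum_(l < code_nth (x' s) 2) code_nth (z' s) l) * code_nth (x' s) 1 <=
    \sum_(l < code_nth (x' s) 2) code_nth (z' s) l * code_expr (x' s) l (w s)).
  move=> cx' cz' cw; apply: computable_leq.
    by apply: computable_mul; [exact: total|exact: computable_code_nth].
  apply: (@computable_sum (fun l s => code_nth (z' s) l * code_expr (x' s) l (w s)));
    last exact: computable_code_nth.
  apply: computable_mul.
    by apply: computable_code_nth; [exact: computable_drop|exact: computable_nth].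
  by apply: computable_code_expr; solve [exact: computable_nth|exact: computable_drop].
apply: computable_and; first by apply: computable_ltn => //; exact: total.
apply: (@computable_forall (fun w s => (\sum_(l < code_nth (x s) 2) code_nth (z s) l) *
  code_nth (x s) 1 <=
    \sum_(l < code_nth (x s) 2) code_nth (z s) l * code_expr (x s) l w)).
  by apply: inner; solve [exact: computable_nth|exact: computable_drop].
exact/computable_pred/computable_code_size.
Qed.

Lemma computable_decide : computable (fun s => decide (nth 0 s 0)).
Proof.
pose g z s := ~~ (primal (nth 0 s 0) z || dual (nth 0 s 0) z) : nat.
have cg : computable (fun s => g (nth 0 s 0) (drop 1 s)).
  have cx : computable (fun s => nth 0 (drop 1 s) 0) by exact: (computable_drop 1
    (computable_nth 0)).
  apply/computable_not/computable_or.
    by apply: computable_primal => //; exact: computable_nth.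
  by apply: computable_dual => //; exact: computable_nth.
have g0 s : exists z, g z s == 0.
  by have [z xz] := primal_or_dual (nth 0 s 0); exists z; rewrite /g xz.
have cm := computable_mu cg g0.
have e s : ex_minn (g0 s) = ex_minn (primal_or_dual (nth 0 s 0)).
  case: ex_minnP => a; rewrite eqb0 negbK => pa amin.
  case: ex_minnP => b pb bmin; apply/eqP; rewrite eqn_leq amin ?bmin //.
  by rewrite eqb0 negbK.
move=> k; apply: (recursive_ext (computable_not (computable_primal (computable_nth 0) cm)
  k)) => v.
by rewrite /decide e.
Qed.

(** * Correctness on encoded inequalities *)

Lemma code_nth_encode n k q (d : 'I_k.+1 -> coefs nat n) :
  [/\ code_nth (encode q d) 0 = n, code_nth (encode q d) 1 = q,
      code_nth (encode q d) 2 = k.+1 &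
      forall (l : 'I_k.+1) a b, a < 2 ^ n -> b < 2 ^ n ->
        code_entry (encode q d) l a b = d l (bits n b) (bits n a)].
Proof.
split; rewrite ?code_nthE // => l a b alt blt.
rewrite /code_entry !code_nthE /=.
have -> : (l * 2 ^ n + a) * 2 ^ n + b = l * (2 ^ n * 2 ^ n) + (a * 2 ^ n + b) by nia.
rewrite (nth_flatten_uniform 0 l (N := 2 ^ n * 2 ^ n)) ?size_enum_ord //; last first.
- by nia.
- by move=> i; rewrite size_allpairs !size_iota.
rewrite nth_ord_enum (nth_flatten_uniform 0 0 (N := 2 ^ n)
  (F := fun a => [seq d l (bits n y) (bits n a) | y <- iota 0 (2 ^ n)])) ?size_iota //;
    last first.
  by move=> i; rewrite size_map size_iota.
by rewrite (nth_map 0) ?size_iota // !nth_iota.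
Qed.

Local Open Scope ring_scope.

Definition step_expr (n : nat) (d : coefs nat n) (W : {set 'I_n}) : nat :=
  (\sum_(X : {set 'I_n}) \sum_(Y : {set 'I_n})
     ((X \subset Y) && ((X \subset W) && ~~ (Y \subset W))) * d Y X)%N.

Lemma linear_expr_step (R : realType) (n : nat) (d : coefs nat n) (W : {set 'I_n}) :
  linear_expr (real_coefs R d) (step R W) = (step_expr d W)%:R.
Proof.
rewrite /step_expr natr_sum; apply: eq_bigr => X _.
rewrite natr_sum big_mkcond; apply: eq_bigr => Y _.
case: ifPn => XY; last by rewrite /= mul0n.
rewrite /real_coefs /cond /step (setUidPr XY) natrM mulrC /=; congr (_ * _).
have [YW|YW] := boolP (Y \subset W); first by rewrite (subset_trans XY YW) subrr.
by case: ifP => _; rewrite ?subr0 ?subrr.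
Qed.

Lemma code_expr_encode n k q (d : 'I_k.+1 -> coefs nat n) (l : 'I_k.+1) w :
  code_expr (encode q d) l w = step_expr (d l) (bits n w).
Proof.
have [e0 _ _ eE] := code_nth_encode q d.
rewrite /code_expr /step_expr /code_cond e0 sum_bits; apply: eq_bigr => a _.
rewrite sum_bits; apply: eq_bigr => b _.
by rewrite !subset_bitsE eE ?ltn_ord.
Qed.

(** Relating [z] to [c] only on the relevant indices allows passage both from weights to a code and
    from an arbitrary number to weights. *)
Lemma step_violation_primal (R : realType) n k q (d : 'I_k.+1 -> coefs nat n)
    (c : {set 'I_n} -> nat) z :
  (forall w, (w < (2 ^ n).-1)%N -> code_nth z w = c (bits n w)) ->
  step_violation q%:R (fun l => real_coefs R (d l)) c <-> primal (encode q d) z.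
Proof.
move=> zc; have [e0 e1 e2 _] := code_nth_encode q d.
have E l : (0 < \sum_(W : {set 'I_n} | W \proper setT)
      (c W)%:R * (q%:R - linear_expr (real_coefs R (d l)) (step R W))) =
    (\sum_(w < (2 ^ n).-1) code_nth z w * code_expr (encode q d) l w <
    (\sum_(w < (2 ^ n).-1) code_nth z w) * q)%N.
  under eq_bigr do rewrite linear_expr_step.
  rewrite sum_deficit subr_gt0 ltr_nat !sum_bits_proper.
  by congr (_ < _ * _)%N; apply: eq_bigr => w _; rewrite zc ?code_expr_encode.
rewrite /primal e0 e1 e2; split=> [v|/forallP v l]; last by rewrite E.
by apply/forallP => l; rewrite -E.
Qed.

Lemma simple_ineq_decidableP (R : realType) : simple_ineq_decidable R.
Proof.
exists (fun v => decide (tnth v ord0)); split=> [|n k q d _ ds].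
  by apply: (recursive_ext (computable_decide 1)) => v; rewrite (tnth_nth 0%N).
rewrite (tnth_nth 0%N) /=; congr nat_of_bool; apply/idP/asboolP.
all: have dc l : conditional (real_coefs R (d l)) by move=> X Y _; rewrite /real_coefs ler0n.
all: rewrite (propext (valid_entropicP q%:R dc ds)).
- move=> /decideP np c; pose z := CodeSeq.code (mkseq (c \o bits n) (2 ^ n).-1).
  by rewrite (@step_violation_primal R n k q d c z) => [|w];
    [exact/negP|exact: nth_code_mkseq].
- move=> nv; apply/decideP => z; apply/negP.
  have [g gK _] := bits_bij n.
  rewrite -(@step_violation_primal R n k q d (fun W => code_nth z (g W)) z); first exact: nv.
  move=> w wlt; have wn : (w < 2 ^ n)%N by rewrite (leq_trans wlt) ?leq_pred.
  by rewrite (gK (Ordinal wn)).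
Qed.

Unset Implicit Arguments.

Theorem theorem3p12 (R : realType) :
  (forall (n k : nat) (q : R) (d : 'I_k.+1 -> coefs R n),
      0 < q -> (forall l, conditional (d l)) ->
      [/\ (forall l, unconditioned (d l)) ->
            (valid_on (@modular R n) q d <-> valid_on (@polymatroid R n) q d),
          (forall l, simple (d l)) ->
            (valid_on (@normal R n) q d <-> valid_on (@polymatroid R n) q d) &
          (forall l, simple (d l)) ->
            (valid_on (@entropic R n) q d <-> valid_on (@polymatroid R n) q d)])
  /\ simple_ineq_decidable R.
Proof.
split=> [n k q d _|]; first exact: valid_on_equivalences.
exact: simple_ineq_decidableP.
Qed.
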